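(* Let $w\in S_n$ be a Grassmannian permutation with unique descent at position $k$, and let $\lambda=(w_k-k,w_{k-1}-(k-1),\ldots,w_1-1)$ be its associated partition. Let $P(\lambda)=(P_1,\ldots,P_r)$. Then the (total) degree of the Grothendieck polynomial $\mathfrak G_w$ is \[\deg(\mathfrak G_w)=|\lambda|+\sum_{h=1}^{r-1}|P_{h+1}|\cdot\operatorname{sylv}(\lambda^{(h)}).\]
   Context: Grothendieck polynomials: $S_n$ acts on $\mathbb Z[x_1,\ldots,x_n]$ by permuting variables; $s_i$ is the transposition of $i,i+1$. Define $\partial_i f=(f-s_if)/(x_i-x_{i+1})$ and $\pi_i f=\partial_i((1-x_{i+1})f)$. Set $\mathfrak G_{w_0}=x_1^{n-1}x_2^{n-2}\cdots x_{n-1}$ for $w_0=n\,(n-1)\cdots 1$, and whenever $w(i)>w(i+1)$ set $\mathfrak G_{s_iw}=\pi_i(\mathfrak G_w)$; this determines $\mathfrak G_w$ for all $w\in S_n$. The degree is the largest total degree of a monomial appearing. Permutations are in one-line notation $w=w_1\cdots w_n$; $w$ has a descent at $k$ if $w_k>w_{k+1}$; $w$ is Grassmannian if it has exactly one descent. Partitions: $\lambda=(\lambda_1,\ldots,\lambda_k)$ weakly decreasing nonnegative integers, $|\lambda|=\sum\lambda_i$, identified with Young diagrams. $P(\lambda)=(P_1,\ldots,P_r)$ is the ordered set partition of $\{1,\ldots,k\}$ such that $i,j$ are in the same block iff $\lambda_i=\lambda_j$, and $\lambda_i>\lambda_j$ whenever $i\in P_h$, $j\in P_l$, $h<l$. For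 $1\le h\le r-1$, $\lambda^{(h)}=(\lambda_1-\lambda_i,\ldots,\lambda_{i-1}-\lambda_i)$ with $i=\min P_{h+1}$. For a partition $\nu$, $\operatorname{sylv}(\nu)=\max\{m\ge0:(m,m-1,\ldots,1)\subseteq\nu\}$. *)

(* Defs.v *)
From HB Require Import structures.
From mathcomp Require Import all_boot all_order all_algebra all_fingroup.
From mathcomp Require Import mpoly.
From Stdlib Require Import ClassicalEpsilon.
Set Implicit Arguments. Unset Strict Implicit. Unset Printing Implicit Defensive.
Import GRing.Theory.
Local Open Scope ring_scope.

(* Conventions: the variable x_j (1 <= j <= n) is 'X_(j-1) : {mpoly int[n]};
   position j of a permutation is the ordinal j-1, and the value w_j is
   (w (j-1)).+1.  s_i (1 <= i <= n-1) corresponds to the 0-indexed pair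
   (a, b) = (i-1, i). *)

Definition swapvar n (a b : 'I_n) (f : {mpoly int[n]}) : {mpoly int[n]} :=
  msym (tperm a b) f.

(* Divided difference: the (unique, {mpoly int[n]} being a domain) g with
   (x_a - x_b) g = f - s f. *)
Definition ddiff n (a b : 'I_n) (f : {mpoly int[n]}) : {mpoly int[n]} :=
  epsilon (inhabits 0)
    (fun g : {mpoly int[n]} => ('X_a - 'X_b) * g = f - swapvar a b f).

Definition pidiff n (a b : 'I_n) (f : {mpoly int[n]}) : {mpoly int[n]} :=
  ddiff a b ((1 - 'X_b) * f).

Definition w0 n : 'S_n := perm (@rev_ord_inj n).

Definition groth_top n : {mpoly int[n]} :=
  \prod_(i < n) 'X_i ^+ (n.-1 - i)%N.

(* Recursive computation of G_w: if w <> w0, pick an ascent a < b = a+1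
   (w(a) < w(b)); then w = s_a w' where w' is w with positions a, b swapped,
   w' has a descent at a, and G_w = pi_a G_{w'}.  The fuel n*n exceeds the
   number of steps needed (each step increases the inversion number). *)
Fixpoint groth_fuel n (fuel : nat) (w : 'S_n) : {mpoly int[n]} :=
  if w == w0 n then groth_top n else
  match fuel with
  | 0 => 0
  | fuel'.+1 =>
    match [pick ab : 'I_n * 'I_n |
             (val ab.2 == (val ab.1).+1)%N && (w ab.1 < w ab.2)%N] with
    | Some ab => pidiff ab.1 ab.2 (groth_fuel fuel' (tperm ab.1 ab.2 * w)%g)
    | None => 0
    end
  end.

Definition groth n (w : 'S_n) : {mpoly int[n]} := groth_fuel (n * n) w.

Definition mpoly_deg n (p : {mpoly int[n]}) : nat :=
  (\max_(m <- msupp p) mdeg m)%N.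

Definition oneline n (w : 'S_n) : seq nat := [seq (w i).+1 | i <- enum 'I_n].

Definition wval n (w : 'S_n) (j : nat) : nat := nth 0 (oneline w) j.-1.

Definition descents n (w : 'S_n) : seq nat :=
  [seq k <- iota 1 n.-1 | (wval w k.+1 < wval w k)%N].

Definition grass_partition n (w : 'S_n) (k : nat) : seq nat :=
  [seq (wval w (k.+1 - i) - (k.+1 - i))%N | i <- iota 1 k].

Definition psize (lam : seq nat) : nat := sumn lam.

Definition nblocks (lam : seq nat) : nat := size (undup lam).

Definition Pblock (lam : seq nat) (h : nat) : seq nat :=
  [seq i <- iota 1 (size lam) | nth 0 lam i.-1 == nth 0 (undup lam) h.-1].

Definition lam_h (lam : seq nat) (h : nat) : seq nat :=
  let i := head 0%N (Pblock lam h.+1) in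
  [seq (nth 0 lam j.-1 - nth 0 lam i.-1)%N | j <- iota 1 i.-1].

Definition staircase_sub (m : nat) (nu : seq nat) : bool :=
  all (fun j => (m.+1 - j <= nth 0 nu j.-1)%N) (iota 1 m).

(* sylv(nu) = max { m >= 0 : (m, ..., 1) subset nu }; such m satisfy
   m <= size nu, so the max is taken over 0 <= m <= size nu. *)
Definition sylv (nu : seq nat) : nat :=
  (\max_(m < (size nu).+1 | staircase_sub m nu) m)%N.

(* Main.v *)
(* The operators pi_i satisfy the braid relations, so the recursion may use any
   ascent. Reversing the first k values of a Grassmannian w gives a dominant
   permutation u, whose Grothendieck polynomial is the monomial x^e given by its
   code. With A the antisymmetrizer over S_k and rho = prod_i (1 - x_i)^(i-1), one
   has A(rho * pi_i f) = A(rho * f) for i < k; as G_w is symmetric in x_1, ..., x_k,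
   this yields A(rho) * G_w = A(rho * x^e), and for w = 1 also
   A(rho) = A(rho * x^delta). The coefficients of A(rho * x^e) are, up to sign,
   determinants of binomials C(j, d_i - e_j); those are nonnegative, and positive
   when e_j <= d_j <= e_j + j. Hence the degree of A(rho * x^e) is that of the
   largest strictly decreasing d with d_j <= e_j + j, and subtracting the degree
   for w = 1 leaves the sum over j of min_(l <= j) (lambda_l + l) (indices from 0),
   where each summand is lambda_j plus the sylv of the block of j. *)

Require Import Defs.
From mathcomp Require Import all_boot all_order all_algebra all_fingroup.
From mathcomp Require Import mpoly.
From mathcomp Require Import zify ring.
From Stdlib Require Import ClassicalEpsilon.

Set Implicit Arguments. Unset Strict Implicit. Unset Printing Implicit Defensive.
Import GRing.Theory Num.Theory.
Local Open Scope ring_scope.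

(** * Divided differences, the operators pi_i and their braid relations *)

Lemma msymXU n (s : 'S_n) (i : 'I_n) : msym s 'X_i = 'X_(s i) :> {mpoly int[n]}.
Proof.
rewrite msymX; congr mpolyX; apply/mnmP => j; rewrite mnmE !mnm1E.
by rewrite -(inj_eq (@perm_inj _ s)) permKV.
Qed.

Lemma mpolyXU_inj n (a b : 'I_n) : a != b -> 'X_a - 'X_b != 0 :> {mpoly int[n]}.
Proof.
move=> nab; apply/eqP => /(congr1 (mcoeff U_(a))).
by rewrite mcoeffB mcoeff0 !mcoeffXU eqxx eq_sym (negPf nab).
Qed.

(** Divisibility of f - s f by x_a - x_b holds for the variables and passes to products by the
    twisted Leibniz rule, then to linear combinations. So the choice made in [ddiff] is a genuine
    quotient. *)
Lemma ddiff_exists n (a b : 'I_n) (f : {mpoly int[n]}) :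
  exists g, ('X_a - 'X_b) * g = f - swapvar a b f.
Proof.
rewrite /swapvar; set t := tperm a b.
pose Q (f : {mpoly int[n]}) := exists g, ('X_a - 'X_b) * g = f - msym t f.
have QM p q : Q p -> Q q -> Q (p * q).
  move=> [g gE] [h hE]; exists (g * q + msym t p * h).
  by rewrite mulrDr mulrA gE mulrCA hE msymM; ring.
have Q1 : Q 1 by exists 0; rewrite msym1 subrr mulr0.
have QX i : Q 'X_i.
  rewrite /Q msymXU /t; case: tpermP => [->|->|_ _].
  - by exists 1; rewrite mulr1.
  - by exists (-1); ring.
  - by exists 0; ring.
rewrite -/(Q f) (mpolyE f); elim/big_ind: _ => [|p q [g gE] [h hE]|m _].
- by exists 0; rewrite msym0 subrr mulr0.
- by exists (g + h); rewrite mulrDr gE hE msymD; ring.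
have [g gE] : Q 'X_[m].
  rewrite mpolyXE_id; elim/big_ind: _ => // i _.
  by elim: (m i) => [|e IH]; rewrite ?expr0 // exprS; apply: QM.
by exists (f@_m *: g); rewrite -scalerAr gE msymZ scalerBr.
Qed.

Lemma msym1BX n (s : 'S_n) (a : 'I_n) (f : {mpoly int[n]}) :
  msym s ((1 - 'X_a) * f) = (1 - 'X_(s a)) * msym s f.
Proof. by rewrite msymM msymB msym1 msymXU. Qed.

Lemma msymXBX n (s : 'S_n) (a b : 'I_n) (f : {mpoly int[n]}) :
  msym s (('X_a - 'X_b) * f) = ('X_(s a) - 'X_(s b)) * msym s f.
Proof. by rewrite msymM msymB !msymXU. Qed.

(** Permuting the variables in the equation that defines p = pi_i f gives equations for the images
    of p; with these, the commutation and braid relations become identities in a commutative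
    ring. *)
Lemma msym_pi_eq n (s : 'S_n) (a b : 'I_n) (p f g : {mpoly int[n]}) :
  ('X_a - 'X_b) * p = (1 - 'X_b) * f - (1 - 'X_a) * g ->
  ('X_(s a) - 'X_(s b)) * msym s p =
  (1 - 'X_(s b)) * msym s f - (1 - 'X_(s a)) * msym s g.
Proof. by move=> /(congr1 (msym s)); rewrite msymXBX msymB !msym1BX. Qed.

Lemma msym_pi_eq_fixed n (s : 'S_n) (a b : 'I_n) (p f g : {mpoly int[n]}) :
  msym s f = f -> ('X_a - 'X_b) * p = (1 - 'X_b) * f - (1 - 'X_a) * g ->
  ('X_(s a) - 'X_(s b)) * msym s p =
  (1 - 'X_(s b)) * f - (1 - 'X_(s a)) * msym s g.
Proof. by move=> sf /(msym_pi_eq s); rewrite sf. Qed.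

Lemma pidiffE n (a b : 'I_n) (f : {mpoly int[n]}) :
  ('X_a - 'X_b) * pidiff a b f =
  (1 - 'X_b) * f - (1 - 'X_a) * msym (tperm a b) f.
Proof.
rewrite /pidiff /ddiff (epsilon_spec _ _ (ddiff_exists a b _)) /swapvar.
by rewrite msym1BX tpermR.
Qed.

Lemma msym_tpermK n (a b : 'I_n) (f : {mpoly int[n]}) :
  msym (tperm a b) (msym (tperm a b) f) = f.
Proof. by rewrite -msymMm tperm2 msym1m. Qed.

Lemma pidiff_sym n (a b : 'I_n) (f : {mpoly int[n]}) :
  a != b -> msym (tperm a b) (pidiff a b f) = pidiff a b f.
Proof.
move=> nab; apply/(mulfI (mpolyXU_inj nab)); rewrite pidiffE.
have := msym_pi_eq (tperm a b) (pidiffE a b f).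
rewrite tpermL tpermR msym_tpermK => E.
by apply: oppr_inj; rewrite -mulNr opprB E opprB.
Qed.

(** Here [fa], [fc], [fac] are the images of f under the two disjoint transpositions and their
    product; [g1], [g2] are the two values of pi on f, and primes mark images under the other
    transposition. *)
Lemma comm_identity (R : comPzRingType)
    (A B C D f fa fc fac g1 g1' g2 g2' p1 p2 : R) :
  (A - B) * g1 = (1 - B) * f - (1 - A) * fa ->
  (C - D) * g2 = (1 - D) * f - (1 - C) * fc ->
  (A - B) * p1 = (1 - B) * g2 - (1 - A) * g2' ->
  (C - D) * p2 = (1 - D) * g1 - (1 - C) * g1' ->
  (A - B) * g1' = (1 - B) * fc - (1 - A) * fac ->
  (C - D) * g2' = (1 - D) * fa - (1 - C) * fac ->
  (C - D) * ((A - B) * p1) = (C - D) * ((A - B) * p2).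
Proof.
move=> E1 E2 H1 H2 F1 F2.
transitivity ((1 - B) * ((1 - D) * f - (1 - C) * fc)
              - (1 - A) * ((1 - D) * fa - (1 - C) * fac)).
  by rewrite H1 -E2 -F2; ring.
transitivity ((A - B) * ((C - D) * p2)); last by ring.
transitivity ((1 - D) * ((A - B) * g1) - (1 - C) * ((A - B) * g1')).
  by rewrite E1 F1; ring.
by rewrite H2; ring.
Qed.

Lemma tperm_comm n (a b c d : 'I_n) :
  uniq [:: a; b; c; d] -> (tperm c d * tperm a b = tperm a b * tperm c d)%g.
Proof.
rewrite /= !inE !negb_or -!andbA => /and5P[ab ac ad bc /andP[bd /andP[cd _]]].
have := tpermJ a b (tperm c d); rewrite /conjg tpermV !tpermD 1?eq_sym // => E.
by rewrite -[LHS](mulgK (tperm c d)) -(mulgA (tperm c d)) E tpermV.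
Qed.

Lemma pidiff_comm n (a b c d : 'I_n) (f : {mpoly int[n]}) :
  uniq [:: a; b; c; d] ->
  pidiff a b (pidiff c d f) = pidiff c d (pidiff a b f).
Proof.
move=> uabcd; have comm_t := tperm_comm uabcd; move: uabcd; rewrite /= !inE !negb_or -!andbA => /and5P[ab ac ad bc /andP[bd /andP[cd _]]].
have [ca cb da db] : [/\ c != a, c != b, d != a & d != b] by rewrite !(eq_sym c) !(eq_sym d).
apply/(mulfI (mpolyXU_inj ab))/(mulfI (mpolyXU_inj cd)).
have E1 := pidiffE a b f; have F1 := msym_pi_eq (tperm c d) E1.
have E2 := pidiffE c d f; have F2 := msym_pi_eq (tperm a b) E2.
move: F1 F2; rewrite (tpermD ca da) (tpermD cb db) (tpermD ac bc) (tpermD ad bd).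
have -> : msym (tperm c d) (msym (tperm a b) f) = msym (tperm a b) (msym (tperm c d) f).
  by rewrite -!msymMm comm_t.
exact: comm_identity E1 E2 (pidiffE a b _) (pidiffE c d _).
Qed.

Lemma tperm_braid n (a b c : 'I_n) : uniq [:: a; b; c] ->
  (tperm a b * tperm b c * tperm a b = tperm b c * tperm a b * tperm b c)%g.
Proof.
rewrite /= !inE !negb_or -!andbA => /and3P[ab ac /andP[bc _]].
have := tpermJ b c (tperm a b); rewrite /conjg tpermV tpermR tpermD // => E1.
have := tpermJ a b (tperm b c); rewrite /conjg tpermV tpermL tpermD 1?eq_sym // => E2.
by rewrite -mulgA E1 -E2 mulgA.
Qed.

(** The six f's are the S_3-orbit of f, with [fl] the image under the longest element. Times the
    Vandermonde product, both triple composites equal the signed sum over S_3 of the images of (1 -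
    B)(1 - C)^2 f, which is the expression in the first [transitivity]. *)
Lemma braid_identity (R : comPzRingType)
    (A B C f fa fb fab fba fl g1 g1' g1'' g2 g2' g2'' h1 h1' h2 h2' p1 p2 : R) :
  (A - B) * g1 = (1 - B) * f - (1 - A) * fa ->
  (B - C) * g2 = (1 - C) * f - (1 - B) * fb ->
  (A - C) * g1' = (1 - C) * fb - (1 - A) * fab ->
  (A - C) * g2' = (1 - C) * fa - (1 - A) * fba ->
  (B - C) * g1'' = (1 - C) * fba - (1 - B) * fl ->
  (A - B) * g2'' = (1 - B) * fab - (1 - A) * fl ->
  (B - C) * h1 = (1 - C) * g1 - (1 - B) * g1' ->
  (A - B) * h2 = (1 - B) * g2 - (1 - A) * g2' ->
  (A - C) * h1' = (1 - C) * g1 - (1 - A) * g1'' ->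
  (A - C) * h2' = (1 - C) * g2 - (1 - A) * g2'' ->
  (A - B) * p1 = (1 - B) * h1 - (1 - A) * h1' ->
  (B - C) * p2 = (1 - C) * h2 - (1 - B) * h2' ->
  (B - C) * ((A - C) * ((A - B) * p1)) = (B - C) * ((A - C) * ((A - B) * p2)).
Proof.
move=> E1 E2 F1 F2 G1 G2 H1 H2 K1 K2 L1 L2.
transitivity ((1 - C) * (1 - C) * ((1 - B) * f - (1 - A) * fa)
  - (1 - B) * (1 - B) * ((1 - C) * fb - (1 - A) * fab)
  + (1 - A) * (1 - A) * ((1 - C) * fba - (1 - B) * fl)).
  rewrite -E1 -F1 -G1.
  transitivity ((A - C) * (1 - B) * ((B - C) * h1)
                - (B - C) * (1 - A) * ((A - C) * h1')).
    by rewrite L1; ring.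
  by rewrite H1 K1; ring.
transitivity ((A - C) * ((1 - C) * ((A - B) * h2))
              - (A - B) * ((1 - B) * ((A - C) * h2'))).
  rewrite H2 K2.
  transitivity ((1 - B) * (1 - C) * ((B - C) * g2)
    - (1 - C) * (1 - A) * ((A - C) * g2')
    + (1 - B) * (1 - A) * ((A - B) * g2'')); last by ring.
  by rewrite E2 F2 G2; ring.
transitivity ((A - C) * (A - B) * ((B - C) * p2)); last by ring.
by rewrite L2; ring.
Qed.

Lemma pidiff_braid n (a b c : 'I_n) (f : {mpoly int[n]}) :
  uniq [:: a; b; c] ->
  pidiff a b (pidiff b c (pidiff a b f)) = pidiff b c (pidiff a b (pidiff b c f)).
Proof.
move=> abc; have braid := tperm_braid abc.
move: abc; rewrite /= !inE !negb_or -!andbA => /and3P[ab ac /andP[bc _]].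
have tac : (tperm a b a = b) * (tperm a b b = a) * (tperm a b c = c)
         * (tperm b c a = a) * (tperm b c b = c) * (tperm b c c = b).
  by rewrite !tpermL !tpermR !tpermD // eq_sym.
apply/(mulfI (mpolyXU_inj ab))/(mulfI (mpolyXU_inj ac))/(mulfI (mpolyXU_inj bc)).
have E1 := pidiffE a b f; have E2 := pidiffE b c f.
have F1 := msym_pi_eq (tperm b c) E1; have G1 := msym_pi_eq (tperm a b) F1.
have F2 := msym_pi_eq (tperm a b) E2; have G2 := msym_pi_eq (tperm b c) F2.
have H1 := pidiffE b c (pidiff a b f); have K1 := msym_pi_eq_fixed (pidiff_sym f ab) H1.
have H2 := pidiffE a b (pidiff b c f); have K2 := msym_pi_eq_fixed (pidiff_sym f bc) H2.
have L1 := pidiffE a b (pidiff b c (pidiff a b f)).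
have L2 := pidiffE b c (pidiff a b (pidiff b c f)).
move: F1 G1 F2 G2 K1 K2; rewrite !tac => F1 G1 F2 G2 K1 K2.
have longE : msym (tperm b c) (msym (tperm a b) (msym (tperm b c) f)) =
             msym (tperm a b) (msym (tperm b c) (msym (tperm a b) f)).
  by rewrite -!msymMm !mulgA braid.
rewrite longE in G2.
exact: braid_identity E1 E2 F1 F2 G1 G2 H1 H2 K1 K2 L1 L2.
Qed.

(** * Independence of the recursion from the chosen ascents *)

Definition ascent n (w : 'S_n) (a b : 'I_n) : bool :=
  (val b == (val a).+1) && (w a < w b)%N.

(** The number of recursion steps from w up to [w0]; it serves as the induction measure. *)
Definition noninv n (w : 'S_n) : nat :=
  #|[set p : 'I_n * 'I_n | (p.1 < p.2)%N && (w p.1 < w p.2)%N]|.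

Lemma noninv_le n (w : 'S_n) : (noninv w <= n * n)%N.
Proof. by rewrite -[n in (_ <= n * _)%N]card_ord -[n in (_ <= _ * n)%N]card_ord -card_prod max_card. Qed.

Lemma ltn_tperm_succ n (a b x y : 'I_n) :
  val b = (val a).+1 -> (x, y) != (a, b) -> (x < y)%N -> (tperm a b x < tperm a b y)%N.
Proof.
move=> ba; rewrite xpair_eqE => nxy xy.
case: tpermP => [xa|xb|/eqP xa /eqP xb]; case: tpermP => [ya|yb|/eqP ya /eqP yb];
  move: nxy xy ba; rewrite -?val_eqE /= ?xa ?xb ?ya ?yb; 
  try (move: xa xb); try (move: ya yb); rewrite -?val_eqE /=; lia.
Qed.

(** Swapping adjacent positions a, b destroys the pair (a, b) and permutes the remaining
    non-inversions by [phi], since an adjacent transposition keeps the order of every other pair. *)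
Lemma noninv_tperm n (w : 'S_n) (a b : 'I_n) :
  ascent w a b -> noninv w = (noninv (tperm a b * w)).+1.
Proof.
case/andP=> /eqP ba wab; rewrite /noninv (cardsD1 (a, b)) inE /= wab ba ltnSn /= add1n.
pose phi (p : 'I_n * 'I_n) := (tperm a b p.1, tperm a b p.2).
have phiK : involutive phi by case=> x y; rewrite /phi !tpermK.
congr _.+1; rewrite -(on_card_preimset (f := phi)); last first.
  by apply: onW_bij; exact: inv_bij.
apply: eq_card => -[x y]; rewrite !inE /= !permM.
case wxy: (w (tperm a b x) < w (tperm a b y))%N; last by rewrite !andbF.
rewrite /phi /=; apply/and3P/andP => [[nab txy _] | [xy _]]; last first.
  have nab : (x, y) != (a, b).
    by apply/eqP => -[xa yb]; move: wxy; rewrite xa yb tpermL tpermR ltnNge ltnW.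
  split=> //; last exact: ltn_tperm_succ.
  apply/eqP => -[ta tb]; move: xy.
  by rewrite -[x](tpermK a b) ta -[y](tpermK a b) tb tpermL tpermR ba ltnNge leqnSn.
by split=> //; rewrite -[x](tpermK a b) -[y](tpermK a b); exact: ltn_tperm_succ.
Qed.

(** The values drop by at least one at every position, and n of them fit in 0, ..., n-1 only as n-1,
    ..., 0. *)
Lemma no_ascent_w0 n (w : 'S_n) : (forall a b, ~~ ascent w a b) -> w = w0 n.
Proof.
move=> H.
have dec (d : nat) (i j : 'I_n) : (j = i + d :> nat)%N -> (w j + d <= w i)%N.
  elim: d i j => [|d IH] i j ij.
    by rewrite addn0; have -> : j = i by apply: val_inj; rewrite /= ij addn0.
  have ltd : (i + d < n)%N by have := ltn_ord j; rewrite ij; lia.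
  have := IH i (Ordinal ltd) erefl; have := H (Ordinal ltd) j.
  rewrite /ascent /= ij addnS eqxx /= -leqNgt.
  have : w (Ordinal ltd) != w j.
    by rewrite (inj_eq perm_inj) -val_eqE /= ij; lia.
  rewrite -val_eqE /=; lia.
apply/permP => i; rewrite permE; apply: val_inj => /=.
have n_gt0 : (0 < n)%N := leq_ltn_trans (leq0n i) (ltn_ord i).
have l0 : (n.-1 < n)%N by rewrite prednK.
have := dec i (Ordinal n_gt0) i erefl.
have := dec (n.-1 - i)%N i (Ordinal l0); rewrite /= subnKC; last by have := ltn_ord i; lia.
move=> /(_ erefl); have := ltn_ord (w (Ordinal n_gt0)); have := ltn_ord i; lia.
Qed.

Lemma groth_fuelE n (w : 'S_n) fuel fuel' :
  (noninv w <= fuel)%N -> (noninv w <= fuel')%N ->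
  groth_fuel fuel w = groth_fuel fuel' w.
Proof.
elim: fuel fuel' w => [|f IH] [|f'] w; first by [].
- rewrite /=; rewrite leqn0 => /eqP w00 _; case: eqP => // _; case: pickP => // -[a b] /=.
  by move=> /noninv_tperm; rewrite w00.
- rewrite /= => _; rewrite leqn0 => /eqP w00; case: eqP => // _; case: pickP => // -[a b] /=.
  by move=> /noninv_tperm; rewrite w00.
move=> le1 le2; rewrite /=; case: eqP => [_|_]; first by [].
case: pickP => [[a b] /= /noninv_tperm E|_]; last by [].
by congr pidiff; apply: IH; rewrite -ltnS -E.
Qed.

Lemma groth_w0 n : groth (w0 n) = groth_top n.
Proof. by rewrite /groth; case: (n * n)%N => [|m] /=; rewrite eqxx. Qed.

Lemma groth_pick n (w : 'S_n) : w != w0 n -> exists a b,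
  ascent w a b /\ groth w = pidiff a b (groth (tperm a b * w)%g).
Proof.
move=> nw; have := noninv_le w; rewrite /groth.
case E: (n * n)%N => [|m] le.
  suff : w = w0 n by move/eqP: nw.
  apply: no_ascent_w0 => a b; apply: contraTN le => /noninv_tperm ->.
  by rewrite ltn0.
rewrite {1}/groth_fuel (negPf nw) -/groth_fuel.
case: pickP => [[a b] /= asc | nasc]; last first.
  by case/eqP: nw; apply: no_ascent_w0 => a b; have := nasc (a, b); rewrite /ascent /= => ->.
exists a, b; split; first by []; congr pidiff.
(* The recursive call has one unit of fuel less than [groth]; after the swap either amount
   suffices. *)
by apply: (@groth_fuelE _ _ m m.+1);
  rewrite -ltnS -(noninv_tperm (asc : ascent w a b)) // leqW.
Qed.

Lemma tperm_mulE n (w : 'S_n) (a b : 'I_n) :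
  ((tperm a b * w)%g a = w b) * ((tperm a b * w)%g b = w a) *
  (forall x, a != x -> b != x -> (tperm a b * w)%g x = w x).
Proof.
by do ![split]; [rewrite permM tpermL | rewrite permM tpermR | move=> x ax bx; rewrite permM tpermD].
Qed.

(** Induction on [noninv], comparing the given ascent (a, b) with the ascent (c, d) chosen by the
    recursion: they coincide, overlap in one position (braid relation) or are disjoint
    (commutation). In the last two cases both sides are expanded to a common permutation. *)
Lemma groth_ascent n (w : 'S_n) (a b : 'I_n) :
  ascent w a b -> groth w = pidiff a b (groth (tperm a b * w)%g).
Proof.
have [m] := ubnP (noninv w); elim: m w a b => // m IH w a b lem asc.
have le_t v c d : ascent v c d -> (noninv v < m)%N -> (noninv (tperm c d * v) < m)%N.
  by move/noninv_tperm=> -> /ltnW.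
have le_w c d : ascent w c d -> (noninv (tperm c d * w) < m)%N.
  by move/noninv_tperm=> E; move: lem; rewrite E ltnS.
have nw : w != w0 n.
  apply/eqP => ww0; case/andP: asc; rewrite ww0 !permE /= => /eqP ->; lia.
(* Overlapping ascents give w x < w y < w z, so three swaps are possible along either side of the
   braid. *)
have consec x y z : ascent w x y -> ascent w y z ->
    pidiff x y (groth (tperm x y * w)) = pidiff y z (groth (tperm y z * w)).
  move=> axy ayz; have := axy; have := ayz.
  case/andP=> /eqP zy wyz /andP[/eqP yx wxy].
  have uxyz : uniq [:: x; y; z] by rewrite /= !inE -!val_eqE zy yx /=; lia.
  move: (uxyz); rewrite /= !inE !negb_or -!andbA => /and3P[xy xz /andP[nyz _]].
  have wxz := ltn_trans wxy wyz.
  have [yx' zx zy'] : [/\ y != x, z != x & z != y] by rewrite !(eq_sym z) eq_sym.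
  have A1 : ascent (tperm x y * w) y z.
    by rewrite /ascent zy eqxx /= !tperm_mulE // xz.
  have A2 : ascent (tperm y z * (tperm x y * w)) x y.
    by rewrite /ascent yx eqxx /= !tperm_mulE.
  have B1 : ascent (tperm y z * w) x y.
    by rewrite /ascent yx eqxx /= !tperm_mulE.
  have B2 : ascent (tperm x y * (tperm y z * w)) y z.
    by rewrite /ascent zy eqxx /= !tperm_mulE.
  rewrite (IH _ _ _ (le_w _ _ axy) A1) (IH _ _ _ (le_t _ _ _ _ A1 (le_w _ _ axy)) A2).
  rewrite (IH _ _ _ (le_w _ _ ayz) B1) (IH _ _ _ (le_t _ _ _ _ B1 (le_w _ _ ayz)) B2).
  rewrite (pidiff_braid _ uxyz).
  congr (pidiff _ _ (pidiff _ _ (pidiff _ _ (groth _)))).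
  by rewrite !mulgA (tperm_braid uxyz).
have [c [d [acd ->]]] := groth_pick nw.
have [ba dc] : val b = (val a).+1 /\ val d = (val c).+1.
  by case/andP: asc => /eqP -> _; case/andP: acd => /eqP -> _.
have [ac | nac] := eqVneq a c.
  have -> : d = b by apply: val_inj; rewrite dc ba ac.
  by rewrite ac.
have [bc | nbc] := eqVneq b c.
  by rewrite -bc in acd *; rewrite (consec a b d).
have [ad | nad] := eqVneq a d.
  by rewrite -ad in acd *; rewrite (consec c a b).
have uabcd : uniq [:: a; b; c; d].
  move: nac nbc nad; rewrite /= !inE -!val_eqE ba dc /=; lia.
move: (uabcd); rewrite /= !inE !negb_or -!andbA => /and5P[ab _ _ _ /andP[bd /andP[cd _]]].
have [ca cb da db] : [/\ c != a, c != b, d != a & d != b].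
  by rewrite !(eq_sym c) !(eq_sym d).
have A1 : ascent (tperm c d * w) a b.
  by case/andP: asc => *; rewrite /ascent !tperm_mulE // ba eqxx.
have A2 : ascent (tperm a b * w) c d.
  by case/andP: acd => *; rewrite /ascent !tperm_mulE // dc eqxx.
rewrite (IH _ _ _ (le_w _ _ acd) A1) (IH _ _ _ (le_w _ _ asc) A2).
rewrite pidiff_comm; last by rewrite -(rot_uniq 2).
congr (pidiff _ _ (pidiff _ _ (groth _))); rewrite !mulgA; congr (_ * w)%g.
by rewrite (tperm_comm uabcd).
Qed.

(** * Dominant permutations and their monomial Grothendieck polynomials *)

(** Avoidance of the pattern 132 characterizes the dominant permutations; [code] is the Lehmer
    code. *)
Definition avoids132 n (u : 'S_n) : Prop :=
  forall i j l : 'I_n, (i < j)%N -> (j < l)%N -> ~~ ((u i < u l)%N && (u l < u j)%N).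

Definition code n (u : 'S_n) (i : 'I_n) : nat :=
  #|[set j : 'I_n | (i < j)%N && (u j < u i)%N]|.

Lemma pi_identity (R : comPzRingType) (x y m : R) :
  (1 - y) * (x * m) - (1 - x) * (y * m) = (x - y) * m.
Proof. ring. Qed.

Lemma pidiff_mpolyX n (a b : 'I_n) (m : 'X_{1..n}) : a != b -> m a = m b ->
  pidiff a b 'X_[U_(a) + m] = 'X_[m].
Proof.
move=> ab mab; apply/(mulfI (mpolyXU_inj ab)).
rewrite pidiffE mpolyXD msymM msymXU msymX tpermL tpermV.
have -> : [multinom m (tperm a b i) | i < n] = m; last exact: pi_identity.
by apply/mnmP => i; rewrite mnmE; case: tpermP => [->|->|].
Qed.

(** The leftmost ascent works: the values up to its position a decrease. *)
Lemma first_ascent n (u : 'S_n) : u != w0 n -> exists a b,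
  ascent u a b /\ (forall i : 'I_n, (i < a)%N -> (u a < u i)%N).
Proof.
move=> nu; have [a0 [b0 [asc0 _]]] := groth_pick nu.
pose P x := [exists y : 'I_n, ascent u x y].
have Pa0 : P a0 by apply/existsP; exists b0.
case: (arg_minnP (fun x : 'I_n => val x) Pa0) => a /existsP[b asc] min_a.
exists a, b; split=> // i ia.
have lei (d : nat) (j : 'I_n) : (a = j + d :> nat)%N -> (u a <= u j)%N.
  elim: d j => [|d IH] j aj; first by rewrite addn0 in aj; rewrite (val_inj aj).
  have ltj : (j.+1 < n)%N by have := ltn_ord a; rewrite aj; lia.
  apply: leq_trans (IH (Ordinal ltj) _) _; first by rewrite /= aj; lia.
  rewrite leqNgt; apply/negP => lt_u.
  have Pj : P j by apply/existsP; exists (Ordinal ltj); rewrite /ascent eqxx.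
  by have := min_a j Pj; rewrite /= aj; lia.
have := lei (a - i)%N i (esym (subnKC (ltnW ia))).
rewrite leq_eqVlt => /orP[/eqP/val_inj/perm_inj ai|//].
by rewrite ai ltnn in ia.
Qed.

(** A 132 pattern after the swap either comes from one in u or uses the new descent at a, b as its
    last two letters; the latter needs a value smaller than u a before a, which the choice of the
    leftmost ascent excludes. *)
Lemma avoids132_tperm n (u : 'S_n) (a b : 'I_n) :
  avoids132 u -> ascent u a b -> (forall i : 'I_n, (i < a)%N -> (u a < u i)%N) ->
  avoids132 (tperm a b * u)%g.
Proof.
move=> av /andP[/eqP ba ab] fst i j l ij jl; rewrite !permM.
have [[ia jb]|nij] := eqVneq (i, j) (a, b).
  by rewrite ia jb tpermL tpermR; apply/negP => /andP[]; lia.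
have [[ja lb]|njl] := eqVneq (j, l) (a, b).
  rewrite ja lb tpermL tpermR tpermD; last 2 first.
  - by rewrite -val_eqE /=; move: ij; rewrite ja; lia.
  - by rewrite -val_eqE ba /=; move: ij; rewrite ja; lia.
  have := fst i; rewrite -ja ij => /(_ isT); lia.
by apply: av; apply: ltn_tperm_succ.
Qed.

(** A later value strictly between u a and u b would complete a 132 pattern. *)
Lemma code_eq_ascent n (u : 'S_n) (a b : 'I_n) :
  avoids132 u -> ascent u a b -> code u a = code u b.
Proof.
move=> av /andP[/eqP ba ab]; apply: eq_card => j; rewrite !inE.
apply/andP/andP => -[lt1 lt2].
  split; last exact: ltn_trans ab.
  rewrite ltn_neqAle ba lt1 andbT -ba; apply: contraTneq lt2 => /val_inj <-.
  by rewrite -leqNgt ltnW.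
have aj : (a < j)%N by rewrite ba in lt1; exact: ltnW.
split=> //; have ltab : (a < b)%N by rewrite ba.
have := av _ _ _ ltab lt1; rewrite lt2 andbT -leqNgt leq_eqVlt => /orP[|//].
by move=> /eqP/val_inj/perm_inj ja; rewrite ja ltnn in aj.
Qed.

(** After the swap, position a sees what b saw and also the value u a, now at b; position b sees
    what a saw. As the two entries of the code were equal, only the entry at a grows, by one. *)
Lemma code_tperm n (u : 'S_n) (a b : 'I_n) :
  avoids132 u -> ascent u a b ->
  [multinom code (tperm a b * u)%g i | i < n] =
  (U_(a) + [multinom code u i | i < n])%MM.
Proof.
move=> av asc; have eqab := code_eq_ascent av asc; case/andP: asc => /eqP ba ab.
apply/mnmP => x; rewrite !mnmE.
have -> : code (tperm a b * u)%g x =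
    #|[set j : 'I_n | (x < tperm a b j)%N && (u j < u (tperm a b x))%N]|.
  rewrite /code -(on_card_preimset (f := tperm a b)); last first.
    by apply: onW_bij; exact: inv_bij (tpermK a b).
  by apply: eq_card => j; rewrite !inE !permM tpermK.
have nab : a != b by rewrite -val_eqE ba neq_ltn ltnSn.
have [xa|ax] := eqVneq x a.
  rewrite xa eqab tpermL /code.
  rewrite (cardsD1 a [set j | _]) inE tpermL ba ltnSn ab /=.
  congr (1 + _)%N; apply: eq_card => j; rewrite !inE.
  case: tpermP => [->|->|/eqP ja /eqP jb].
  - by rewrite eqxx /=; lia.
  - by rewrite [(u b < u b)%N]ltnn !andbF.
  rewrite andbA.
  congr (_ && _); move: ja jb; rewrite -!val_eqE ba /=; lia.
rewrite add0n.
have [xb|bx] := eqVneq x b.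
  rewrite xb tpermR -eqab /code; apply: eq_card => j; rewrite !inE.
  case: tpermP => [->|->|/eqP ja /eqP jb].
  - by rewrite [(u a < u a)%N]ltnn !andbF.
  - by rewrite ba; lia.
  by congr (_ && _); move: ba jb; rewrite -val_eqE /=; lia.
rewrite tpermD 1?eq_sym // /code; apply: eq_card => j; rewrite !inE.
move: ba ax bx; case: tpermP => [->|->|//]; rewrite -!val_eqE /= => *; congr (_ && _); lia.
Qed.

(** Descent from [w0] along leftmost ascents: the monomial above u is x_a times one with equal
    exponents at a and b, and pi_a removes that factor x_a. *)
Lemma groth_dominant n (u : 'S_n) :
  avoids132 u -> groth u = 'X_[[multinom code u i | i < n]].
Proof.
have [m] := ubnP (noninv u); elim: m u => // m IH u lem av.
have [-> | nu] := eqVneq u (w0 n).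
  rewrite groth_w0 /groth_top mpolyXE_id; apply: eq_bigr => i _; congr (_ ^+ _).
  rewrite mnmE /code; have -> : [set j : 'I_n | (i < j)%N && (w0 n j < w0 n i)%N] =
    [set j : 'I_n | (i < j)%N].
    apply/setP => j; rewrite !inE !permE /=; apply: andb_idr => ij.
    have := ltn_ord j; lia.
  have -> : [set j : 'I_n | (i < j)%N] = ~: [set j : 'I_n | (j < i.+1)%N].
    by apply/setP => j; rewrite !inE ltnS -ltnNge.
  have := cardsC [set j : 'I_n | (j < i.+1)%N]; rewrite card_ord.
  have -> : #|[set j : 'I_n | (j < i.+1)%N]| = i.+1.
    by rewrite -sum1dep_card -(big_ord_widen _ (fun _ => 1%N) (ltn_ord i)) sum1_card card_ord.
  by have := ltn_ord i; lia.
have [a [b [asc fst]]] := first_ascent nu.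
rewrite (groth_ascent asc) IH; last exact: avoids132_tperm.
  rewrite code_tperm // pidiff_mpolyX //.
    by rewrite -val_eqE; case/andP: asc => /eqP -> _; rewrite neq_ltn ltnSn.
  by rewrite !mnmE; apply: code_eq_ascent.
by move: lem; rewrite (noninv_tperm asc).
Qed.

(** * The antisymmetrizer over S_k and the weight [rho] *)

Definition init n k : {set 'I_n} := [set i : 'I_n | (i < k)%N].

Definition alt n k (f : {mpoly int[n]}) : {mpoly int[n]} :=
  \sum_(s : 'S_n | perm_on (init n k) s) (-1) ^+ s *: msym s f.

Definition rho n k : {mpoly int[n]} := \prod_(i < n | (i < k)%N) (1 - 'X_i) ^+ i.

Lemma altB n k (f g : {mpoly int[n]}) : alt k (f - g) = alt k f - alt k g.
Proof. by rewrite /alt -sumrB; apply: eq_bigr => s _; rewrite msymB scalerBr. Qed.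

Lemma altM n k (f g : {mpoly int[n]}) :
  (forall s, perm_on (init n k) s -> msym s g = g) -> alt k (f * g) = alt k f * g.
Proof.
move=> sg; rewrite /alt mulr_suml; apply: eq_bigr => s Ks.
by rewrite msymM sg // scalerAl.
Qed.

Lemma perm_on_tperm n k (a b : 'I_n) :
  (a < k)%N -> (b < k)%N -> perm_on (init n k) (tperm a b).
Proof.
move=> ak bk; apply: subset_trans (tperm_on a b) _.
by apply/subsetP => x; rewrite !inE => /orP[] /eqP ->.
Qed.

Lemma alt_tperm n k (a b : 'I_n) (f : {mpoly int[n]}) :
  a != b -> (a < k)%N -> (b < k)%N -> alt k (msym (tperm a b) f) = - alt k f.
Proof.
move=> ab ak bk; rewrite /alt -sumrN [RHS](reindex_inj (mulgI (tperm a b))) /=.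
have Kt := perm_on_tperm ak bk.
apply: eq_big => s => [|_].
  apply/idP/idP => Ks; first exact: perm_onM.
  by rewrite -[s](mulKg (tperm a b)) tpermV perm_onM.
by rewrite msymMm odd_permM odd_tperm ab addTb signrN scaleNr opprK.
Qed.

Lemma addrr_inj n (p q : {mpoly int[n]}) : p + p = q + q -> p = q.
Proof.
move=> E; apply/mpolyP => m; have := congr1 (mcoeff m) E.
rewrite !mcoeffD; lia.
Qed.

Lemma pi_scaled (R : comPzRingType) (s a b p f g : R) :
  (a - b) * p = (1 - b) * f - (1 - a) * g ->
  s * ((1 - b) * p) - s * ((1 - a) * p) = s * ((1 - b) * f) - s * ((1 - a) * g).
Proof. by move=> E; rewrite -![RHS]mulrBr -E; ring. Qed.

(** Write [rho] as S (1 - x_b) with S symmetric in x_a, x_b. Since 2 A(g) = A(g - s g) and p = pi_a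
    f is symmetric, doubling both sides leaves A of S (x_a - x_b) p in each case. *)
Lemma alt_pidiff n k (a b : 'I_n) (f : {mpoly int[n]}) :
  val b = (val a).+1 -> (b < k)%N ->
  alt k (rho n k * pidiff a b f) = alt k (rho n k * f).
Proof.
move=> ba bk; have ak : (a < k)%N by rewrite ba in bk; exact: ltnW.
have ab : a != b by rewrite -val_eqE ba neq_ltn ltnSn.
pose r0 : {mpoly int[n]} :=
  \prod_(i < n | [&& (i < k)%N, i != a & i != b]) (1 - 'X_i) ^+ i.
pose S := (1 - 'X_a) ^+ a * (1 - 'X_b) ^+ a * r0.
have rhoE : rho n k = S * (1 - 'X_b).
  rewrite /rho (bigD1 a) //= (bigD1 b) /=; last by rewrite bk eq_sym.
  rewrite ba exprSr /S /r0 (eq_bigl _ _ (fun i => esym (andbA _ _ _))).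
  by rewrite -!mulrA; congr (_ * (_ * _)); rewrite mulrC.
have symS : msym (tperm a b) S = S.
  have sym1BX i : msym (tperm a b) (1 - 'X_i) = 1 - 'X_(tperm a b i) :> {mpoly int[n]}.
    by rewrite msymB msym1 msymXU.
  rewrite /S !msymM !rmorphXn /= !sym1BX tpermL tpermR [X in X * _ = _]mulrC.
  congr (_ * _); rewrite /r0 rmorph_prod /=; apply: eq_bigr => i /and3P[_ ia ib].
  by rewrite rmorphXn /= sym1BX tpermD // eq_sym.
have symSB (g : {mpoly int[n]}) c : msym (tperm a b) (S * ((1 - 'X_c) * g)) =
   S * ((1 - 'X_(tperm a b c)) * msym (tperm a b) g).
  by rewrite msymM symS msym1BX.
have alt2 g h : msym (tperm a b) g = h -> alt k g + alt k g = alt k (g - h).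
  by move=> <-; rewrite altB alt_tperm // opprK.
have rhoM g : rho n k * g = S * ((1 - 'X_b) * g).
  by rewrite rhoE; exact: esym (mulrA _ _ _).
(* It suffices to compare the doubles, integer coefficients having no 2-torsion. *)
apply: addrr_inj; rewrite !rhoM (alt2 _ _ (symSB (pidiff a b f) b)).
rewrite (alt2 _ _ (symSB f b)) tpermR (pidiff_sym f ab).
by congr (alt k _); apply: pi_scaled; exact: pidiffE.
Qed.

(** Adjacent transpositions generate S_k: conjugation yields every transposition, and an induction
    on the number of moved points yields every permutation. *)
Lemma msym_adjacent_fixed n k (f : {mpoly int[n]}) :
  (forall a b : 'I_n, val b = (val a).+1 -> (b < k)%N -> msym (tperm a b) f = f) ->
  forall s, perm_on (init n k) s -> msym s f = f.
Proof.
move=> adj.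
have fix_lt (d : nat) (a b : 'I_n) :
    (b = a + d.+1 :> nat)%N -> (b < k)%N -> msym (tperm a b) f = f.
  elim: d a b => [|d IH] a b abd bk; first by apply: adj => //=; rewrite abd addn1.
  have ltc : (a + d.+1 < n)%N by have := ltn_ord b; rewrite abd; lia.
  pose c := Ordinal ltc.
  have cb : val b = (val c).+1 by rewrite /= abd addnS.
  have ck : (c < k)%N by move: bk; rewrite abd /=; lia.
  have := tpermJ a c (tperm c b); rewrite tpermL tpermD; last 2 first.
  - by rewrite -val_eqE /=; lia.
  - by rewrite -val_eqE /= abd; lia.
  move=> <-; rewrite /conjg tpermV !msymMm (adj c b) // (IH a c) // (adj c b) //.
have fix_t (a b : 'I_n) : (a < k)%N -> (b < k)%N -> msym (tperm a b) f = f.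
  move=> ak bk; case: (ltngtP a b) => [ab|ba|/val_inj ->].
  - by apply: (fix_lt (b - a.+1)%N) => //; lia.
  - by rewrite tpermC; apply: (fix_lt (a - b.+1)%N) => //; lia.
  - by rewrite tperm1 msym1m.
move=> s; have [m] := ubnP #|[set x | s x != x]|; elim: m s => // m IH s lem Ks.
have [-> | [x sx]] : s = 1%g \/ exists x, s x != x.
- case: (pickP (fun x => s x != x)) => [x sx | s1]; [by right; exists x | left].
  by apply/permP => x; rewrite perm1; apply/eqP; move: (s1 x) => /negbFE.
- by rewrite msym1m.
have [xk sxk] : (x < k)%N /\ (s x < k)%N.
  have Kx : x \in init n k by apply: contraR sx => /(out_perm Ks) ->.
  by split; [move: Kx | move: (perm_closed x Ks); rewrite Kx]; rewrite inE.
rewrite -[s](mulgK (tperm x (s x))) tpermV msymMm.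
rewrite IH ?fix_t //.
- rewrite -ltnS; apply: leq_trans lem; rewrite ltnS; apply: proper_card.
  apply/properP; split.
    apply/subsetP => y; rewrite !inE permM; apply: contraNN => /eqP sy.
    rewrite sy tpermD //; first by apply: contraNneq sx => ->; rewrite sy.
    by apply/negP => /eqP E; move: sy; rewrite -E => /perm_inj E2; rewrite E2 eqxx in sx.
  by exists x; rewrite ?inE // permM tpermR eqxx.
by apply: perm_onM => //; apply: perm_on_tperm.
Qed.

Lemma adjacent_trans n (P : 'I_n -> bool) (r : rel 'I_n) : transitive r ->
  (forall i j : 'I_n, (i <= j)%N -> P j -> P i) ->
  (forall a b : 'I_n, val b = (val a).+1 -> P b -> r a b) ->
  forall i j : 'I_n, (i < j)%N -> P j -> r i j.
Proof.
move=> tr Pdown adj i j ij.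
have [d] : exists d, (j = i + d.+1 :> nat)%N by exists (j - i.+1)%N; lia.
elim: d j {ij} => [|d IH] j ijd Pj; first by apply: adj => //=; rewrite ijd addn1.
have ltc : (i + d.+1 < n)%N by have := ltn_ord j; rewrite ijd; lia.
have cj : val j = (val (Ordinal ltc)).+1 by rewrite /= ijd addnS.
apply: tr (adj _ _ cj Pj); apply: IH => //; apply: Pdown Pj.
by rewrite /= ijd; lia.
Qed.

(** Swapping ascents inside the first k positions until none is left sorts these values
    decreasingly, and each swap preserves A(rho G). *)
Lemma alt_rho_groth_reverse n k (w : 'S_n) : exists u : 'S_n,
  [/\ forall i j : 'I_n, (i < j)%N -> (j < k)%N -> (u j < u i)%N,
      forall i : 'I_n, (k <= i)%N -> u i = w i &
      alt k (rho n k * groth w) = alt k (rho n k * groth u)].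
Proof.
have [m] := ubnP (noninv w); elim: m w => // m IH w lem.
case: (pickP (fun p : 'I_n * 'I_n => ascent w p.1 p.2 && (p.2 < k)%N)) =>
    [[a b] /= /andP[asc bk] | noasc].
  have ba : val b = (val a).+1 by case/andP: asc => /eqP.
  have [|u [u1 u2 u3]] := IH (tperm a b * w)%g.
    by move: lem; rewrite (noninv_tperm asc).
  exists u; split=> // [i ki|].
    by rewrite u2 // permM tpermD //; apply: contraTneq ki => <-; move: ba bk => /=; lia.
  by rewrite -u3 (groth_ascent asc) alt_pidiff.
exists w; split=> // i j ij jk.
apply: (@adjacent_trans n (fun x => (x < k)%N) (fun x y => (w y < w x)%N)) => //.
- by move=> y x z /= lt1 lt2; exact: ltn_trans lt2 lt1.
- by move=> x y; exact: leq_ltn_trans.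
move=> a b ba bk; have := noasc (a, b); rewrite /ascent /= bk ba eqxx /= andbT.
move/negbT; rewrite -leqNgt leq_eqVlt => /orP[/eqP/val_inj/perm_inj ab|//].
by move: ba; rewrite ab => /eqP; rewrite eqn_leq ltnn andbF.
Qed.

(** * Nonnegativity and positivity of binomial determinants *)

Lemma det_row_sums (R : comPzRingType) k (I : finType) (M : I -> 'M[R]_k) :
  \det (\matrix_(i, j) \sum_b M b i j) =
  \sum_(f : {ffun 'I_k -> I}) \det (\matrix_(i, j) M (f i) i j).
Proof.
rewrite /determinant exchange_big /=; apply: eq_bigr => s _.
rewrite -mulr_sumr; congr (_ * _).
under eq_bigr do rewrite mxE.
rewrite bigA_distr_bigA /=; apply: eq_bigr => f _.
by apply: eq_bigr => i _; rewrite mxE.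
Qed.

Lemma det_row0 (R : comPzRingType) k (A : 'M[R]_k) i :
  (forall j, A i j = 0) -> \det A = 0.
Proof. by move=> A0; rewrite (expand_det_row A i) big1 // => j _; rewrite A0 mul0r. Qed.

(* The coefficient of x^t in x^e (1 + x)^j. *)
Definition shift_bin (j e t : nat) : nat := if (e <= t)%N then 'C(j, t - e) else 0%N.

Lemma shift_bin0 e t : shift_bin 0 e t = (t == e).
Proof. by rewrite /shift_bin bin0n; case: leqP => [|] h; lia. Qed.

Lemma shift_binS j e t :
  shift_bin j.+1 e t = (shift_bin j e t + (if t is t'.+1 then shift_bin j e t' else 0))%N.
Proof.
rewrite /shift_bin; case: (leqP e t) => [et|te]; last by case: t te => // t te; rewrite leqNgt ltnW.
case: (ltngtP e t) et => // [lt _|-> _]; last first.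
  by case: t => [|t]; rewrite subnn !bin0 ?ltnn ?addn0.
case: t lt => // t; rewrite ltnS => et; rewrite et subSn // binS; lia.
Qed.

Lemma shift_bin_neq0 j e t : shift_bin j e t != 0%N -> (e <= t <= e + j)%N.
Proof.
rewrite /shift_bin; case: leqP => //= et; rewrite -lt0n bin_gt0; lia.
Qed.

(** Up to sign, its determinant is the coefficient of x^d in A(rho * x^e). *)
Definition bin_mx k (d e : 'I_k -> nat) : 'M[int]_k :=
  \matrix_(i, j) (shift_bin j (e j) (d i))%:R.

Definition decreasing k (d : 'I_k -> nat) : Prop := forall i j : 'I_k, (i < j)%N -> (d j < d i)%N.

Lemma decreasing_le k (d : 'I_k.+1 -> nat) : decreasing d -> forall i : 'I_k.+1, (d i + i <= d ord0)%N.
Proof.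
move=> dd [i lti] /=; elim: i lti => [|i IH] lti; first by rewrite addn0; have -> : Ordinal lti = ord0 by apply: val_inj.
have := IH (ltnW lti); have := dd (Ordinal (ltnW lti)) (Ordinal lti) (ltnSn i); lia.
Qed.

Definition tail_fun k (e : 'I_k.+1 -> nat) (j : 'I_k) : nat := e (lift ord0 j).

Lemma tail_fun_decreasing k (e : 'I_k.+1 -> nat) : decreasing e -> decreasing (tail_fun e).
Proof. by move=> de i j ij; apply: de; rewrite /= /bump !add1n ltnS. Qed.

(* Pascal's rule splits each row of a bin_mx into two; f selects the half to keep. *)
Definition step_mx k (d e : 'I_k -> nat) (f : 'I_k -> bool) : 'M[int]_k :=
  \matrix_(i, j) (if f i then (if d i is t.+1 then shift_bin j (e j) t else 0)%N
                  else shift_bin j (e j) (d i))%:R.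

(** Column 0 only tests d_i = e_0. If d_0 < e_0 that column vanishes; if d_0 > e_0, row 0 vanishes
    because e_j + j <= e_0. Otherwise expanding along column 0 leaves binomials with upper index
    j+1, and Pascal's rule with multilinearity in the rows gives the sum. *)
Lemma bin_mx_step k (d e : 'I_k.+1 -> nat) : decreasing d -> decreasing e ->
  \det (bin_mx d e) = if d ord0 == e ord0 then
    \sum_(f : {ffun 'I_k -> bool}) \det (step_mx (tail_fun d) (tail_fun e) f)
  else 0.
Proof.
move=> dd de; case: (ltngtP (d ord0) (e ord0)) => [lt|gt|deq].
- rewrite -det_tr; apply: (det_row0 (i := ord0)) => j.
  rewrite !mxE /= shift_bin0; have := decreasing_le dd j.
  by case: eqP => // ->; lia.
- apply: (det_row0 (i := ord0)) => j; rewrite mxE.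
  apply/eqP; rewrite pnatr_eq0; apply/negPn; apply/negP => /shift_bin_neq0.
  have := decreasing_le de j; lia.
rewrite (expand_det_col _ ord0) big_ord_recl big1 ?addr0 => [|i _]; last first.
  rewrite mxE /= shift_bin0; have := dd ord0 (lift ord0 i) isT.
  by rewrite deq; case: eqP => [->|]; rewrite ?ltnn ?mul0r.
rewrite mxE /= shift_bin0 deq eqxx mul1r /cofactor addn0 expr0 mul1r.
pose M (b : bool) : 'M[int]_k := step_mx (tail_fun d) (tail_fun e) (fun=> b).
transitivity (\det (\matrix_(i, j) \sum_b M b i j)).
  congr (\det _); apply/matrixP => i j; rewrite !mxE big_bool !mxE /=.
  by rewrite /bump /= add1n shift_binS natrD addrC.
rewrite det_row_sums; apply: eq_bigr => f _; congr (\det _).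
by apply/matrixP => i j; rewrite !mxE.
Qed.

Lemma step_mxE k (d e : 'I_k -> nat) (f : 'I_k -> bool) :
  (forall i, f i -> 0 < d i)%N ->
  step_mx d e f = bin_mx (fun i => d i - f i)%N e.
Proof.
move=> row_ok; apply/matrixP => i j; rewrite !mxE; congr (_%:R).
move: (row_ok i); case: (f i) => /=; last by rewrite subn0.
by case: (d i) => [/(_ isT)|t _] //; rewrite subn1.
Qed.

(** Lowering some entries of d by one gives a zero row, two equal rows, or a [bin_mx] whose
    exponents are still strictly decreasing. *)
Lemma step_mx_det_ge0 k (d e : 'I_k -> nat) (f : 'I_k -> bool) :
  (forall d', decreasing d' -> 0 <= \det (bin_mx d' e)) ->
  decreasing d -> 0 <= \det (step_mx d e f).
Proof.
move=> IH dd; have [|row_ok] := boolP [exists i, f i && (d i == 0%N)].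
  move=> /existsP[i /andP[fi /eqP di]].
  by rewrite (det_row0 (i := i)) // => j; rewrite mxE fi di.
rewrite step_mxE => [|i fi]; last first.
  by rewrite lt0n; apply: contraNneq row_ok => di; apply/existsP; exists i; rewrite fi di.
pose d' i := (d i - f i)%N; rewrite -/d'.
have [/injectiveP inj_d | /injectivePn [x [y xy eqd]]] := boolP (injectiveb d'); last first.
  by rewrite (determinant_alternate xy) // => j; rewrite !mxE eqd.
apply: IH => i j ij; have := dd i j ij.
have : d' i != d' j by apply: contraTneq ij => /inj_d ->; rewrite ltnn.
by rewrite /d'; case: (f i); case: (f j); lia.
Qed.

Lemma bin_mx_det_ge0 k (d e : 'I_k -> nat) :
  decreasing d -> decreasing e -> 0 <= \det (bin_mx d e).
Proof.
elim: k d e => [|k IH] d e dd de; first by rewrite det_mx00.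
rewrite bin_mx_step //; case: eqP => // deq; apply: sumr_ge0 => f _.
apply: step_mx_det_ge0; last exact: tail_fun_decreasing.
by move=> d' dd'; apply: IH; last exact: tail_fun_decreasing.
Qed.

Lemma bin_mx_det_gt0 k (d e : 'I_k -> nat) :
  decreasing d -> decreasing e -> (forall j, e j <= d j <= e j + j)%N ->
  0 < \det (bin_mx d e).
Proof.
elim: k d e => [|k IH] d e dd de de_le; first by rewrite det_mx00.
have de0 : d ord0 = e ord0 by have := de_le ord0; rewrite addn0; lia.
have dd' := tail_fun_decreasing dd; have de' := tail_fun_decreasing de.
rewrite bin_mx_step // de0 eqxx.
(* One positive summand suffices. Lowering exactly the entries with d above e keeps d strictly
   decreasing and turns the bound e_j + j + 1 of the tail into e_j + j. *)
pose f0 := [ffun i : 'I_k => tail_fun e i < tail_fun d i]%N.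
rewrite (bigD1 f0) //= ltr_pwDl //; last first.
  by apply: sumr_ge0 => f _; apply: step_mx_det_ge0 => // d'' dd''; apply: bin_mx_det_ge0.
rewrite step_mxE => [|i]; last by rewrite ffunE; lia.
have tail_le j : (tail_fun e j <= tail_fun d j <= tail_fun e j + j.+1)%N.
  exact: de_le (lift ord0 j).
apply: IH => // [i j ij|j].
  have := dd' _ _ ij; have := de' _ _ ij; have := tail_le i; have := tail_le j.
  by rewrite !ffunE; lia.
by have := tail_le j; rewrite !ffunE; lia.
Qed.

(** * The extremal sum of distinct exponents below a decreasing bound *)

Fixpoint runmin (F : nat -> nat) (j : nat) : nat :=
  if j is j'.+1 then minn (runmin F j') (F j) else F 0%N.

Lemma runmin_le F j l : (l <= j)%N -> (runmin F j <= F l)%N.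
Proof.
elim: j => [|j IH] /=; first by rewrite leqn0 => /eqP ->.
by rewrite leq_eqVlt geq_min => /orP[/eqP -> | /IH ->] //; rewrite leqnn orbT.
Qed.

Lemma runmin_ge F j x : (forall l, (l <= j)%N -> (x <= F l)%N) -> (x <= runmin F j)%N.
Proof.
elim: j => [|j IH] xF /=; first exact: xF.
by rewrite leq_min xF // IH // => l lj; apply/xF/leqW.
Qed.

(** Induction on k: the smallest value of b is moved to the last position, where it is bounded by
    counting distinct values, and the other positions are left to the induction hypothesis. *)
Lemma sum_injective_le_runmin k (D b : nat -> nat) :
  (forall i j, i <= j < k -> D j <= D i)%N ->
  (forall i j, i < k -> j < k -> b i = b j -> i = j)%N ->
  (forall i, i < k -> b i <= D i)%N ->
  (\sum_(j < k) b j <= \sum_(j < k) (runmin (fun l => D l + l) j - j))%N.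
Proof.
elim: k b => [|k IH] b Ddec binj bD; first by rewrite !big_ord0.
case: (arg_minnP (P := predT) (fun i : 'I_k.+1 => b i) (isT : predT ord0)) => p _ p_min.
(* This exchanges the values at p and k. The bound by D survives: the value moved to p was at most D
   k <= D p, and the minimum is at most b k <= D k. *)
pose b' i := if i == p :> nat then b k else if i == k then b p else b i.
have b'_perm : (\sum_(j < k.+1) b j = \sum_(j < k.+1) b' j)%N.
  rewrite (reindex_inj (@perm_inj _ (tperm p ord_max))) /=; apply: eq_bigr => i _.
  rewrite /b'; case: tpermP => [->|->|/eqP ip /eqP im]; rewrite /= ?eqxx //.
    by case: eqP => [<-|].
  by rewrite -!val_eqE /= in ip im *; rewrite (negPf ip) (negPf im).
have lep : (p <= k)%N by rewrite -ltnS ltn_ord.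
have b'_inj i j : (i < k.+1 -> j < k.+1 -> b' i = b' j -> i = j)%N.
  rewrite /b' => ik jk; do ![case: eqP => ?] => E; have := fun h1 h2 => binj _ _ h1 h2 E; lia.
have b'D i : (i < k.+1 -> b' i <= D i)%N.
  rewrite /b' => ik; case: eqP => [->|_].
    by apply: leq_trans (bD k _) (Ddec _ _ _); rewrite // lep /=.
  case: eqP => [->|_]; last exact: bD.
  by apply: leq_trans (p_min ord_max _) (bD _ _).
have b'_min i : (i < k.+1 -> b' k <= b' i)%N.
  move=> ik; have -> : b' k = b p by rewrite /b' eqxx; case: eqP => [<-|].
  have bp j (jk : (j < k.+1)%N) : (b p <= b j)%N := p_min (Ordinal jk) isT.
  rewrite /b'; case: eqP => _; [exact: bp | case: eqP => _; [exact: bp | exact: bp]].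
rewrite b'_perm !big_ord_recr /=; apply: leq_add.
  apply: IH => [i j ijk|i j ik jk|i ik].
  - by apply: Ddec; lia.
  - by apply: b'_inj; exact: leqW.
  - by apply: b'D; exact: leqW.
suff : (b' k + k <= runmin (fun l => D l + l) k)%N by lia.
apply: runmin_ge => l lk.
(* Pigeonhole: the k+1-l distinct values at positions l, ..., k all lie between b' k and D l. *)
pose vals := [seq b' i | i <- iota l (k.+1 - l)].
have uniq_vals : uniq vals.
  rewrite map_inj_in_uniq ?iota_uniq // => i j; rewrite !mem_iota => ik jk.
  by apply: b'_inj; lia.
have sub : {subset vals <= iota (b' k) ((D l).+1 - b' k)}.
  move=> y /mapP[i]; rewrite mem_iota => ik ->.
  have := b'_min i; have := b'D i; have := Ddec l i; rewrite mem_iota; lia.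
have := uniq_leq_size uniq_vals sub; rewrite size_map !size_iota.
have := b'_min l; have := b'D l; lia.
Qed.

(** * Coefficients and degree of A(rho * x^e) *)

(** The sign is written with t + e, of the same parity as t - e, to stay clear of truncated
    subtraction. *)
Lemma onesub_expr_expand (R : comPzRingType) (x : R) j e N : (e + j < N)%N ->
  (1 - x) ^+ j * x ^+ e =
  \sum_(t < N) ((-1) ^+ (t + e) * (shift_bin j e t)%:R) * x ^+ t.
Proof.
elim: j N => [|j IH] N ltN.
  rewrite addn0 in ltN; rewrite expr0 mul1r (bigD1 (Ordinal ltN)) //= big1 ?addr0.
    by rewrite shift_bin0 eqxx mulr1 -signr_odd oddD addbb mul1r.
  by move=> i; rewrite -val_eqE /= shift_bin0 => /negPf ->; rewrite mulr0 mul0r.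
case: N ltN => // N; rewrite addnS ltnS => ltN.
transitivity ((1 - x) ^+ j * x ^+ e - x * ((1 - x) ^+ j * x ^+ e)).
  by rewrite exprS; ring.
rewrite {1}(IH N.+1) ?(leqW ltN) // (IH N) // mulr_sumr.
rewrite [X in X - _]big_ord_recl [RHS]big_ord_recl /= -addrA; congr (_ + _).
  by rewrite shift_binS addn0.
rewrite -sumrB; apply: eq_bigr => t _.
by rewrite /bump /= add1n shift_binS natrD exprS addSn exprS; ring.
Qed.

Lemma mcoeff_prod_univariate n N (c : 'I_n -> nat -> int) (m : 'X_{1..n}) :
  (forall i, m i < N)%N ->
  (\prod_i \sum_(t < N) c i t *: 'X_i ^+ t)@_m = \prod_i c i (m i).
Proof.
move=> ltN; rewrite bigA_distr_bigA /= raddf_sum /=.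
pose f0 := [ffun i : 'I_n => Ordinal (ltN i)].
have coefE (f : {ffun 'I_n -> 'I_N}) :
  (\prod_i (c i (f i) *: 'X_i ^+ f i))@_m =
  \prod_i c i (f i) * ([multinom (f i : nat) | i < n] == m)%:R.
  rewrite scaler_prod mcoeffZ; congr (_ * _); rewrite -mcoeffX mpolyXE_id.
  by congr (mcoeff m); apply: eq_bigr => i _; rewrite mnmE.
rewrite (bigD1 f0) //= [X in _ + X]big1 ?addr0 => [|f nf].
  rewrite coefE; have -> : [multinom (f0 i : nat) | i < n] = m.
    by apply/mnmP => i; rewrite mnmE ffunE.
  by rewrite eqxx mulr1; apply: eq_bigr => i _; rewrite ffunE.
rewrite coefE; case: eqP => [fm|_]; last by rewrite mulr0.
case/eqP: nf; apply/ffunP => i; apply: val_inj; rewrite ffunE /= -fm mnmE //.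
Qed.

(** The exponent of 1 - x_i in [rho], extended by 0 so that products run over all n variables. *)
Definition cap (k i : nat) : nat := if (i < k)%N then i else 0%N.

Definition expo n k (E : nat -> nat) : 'X_{1..n} :=
  [multinom if (i < k)%N then E i else 0%N | i < n].

Lemma mcoeff_rhoX n k (E : nat -> nat) (m : 'X_{1..n}) :
  (rho n k * 'X_[expo n k E])@_m =
  \prod_(i < n) ((-1) ^+ (m i + expo n k E i) *
           (shift_bin (cap k i) (expo n k E i) (m i))%:R).
Proof.
set e := expo n k E.
pose N := (mdeg m + mdeg e + n).+1.
have le_mdeg (p : 'X_{1..n}) (i : 'I_n) : (p i <= mdeg p)%N.
  by rewrite mdegE (bigD1 i) //= leq_addr.
rewrite -(@mcoeff_prod_univariate _ N (fun i t => (-1) ^+ (t + e i) * (shift_bin (cap k i) (e i) t)%:R)); last first.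
  by move=> i; have := le_mdeg m i; rewrite /N; lia.
congr (mcoeff m); rewrite /rho big_mkcond mpolyXE_id -big_split /=.
apply: eq_bigr => i _; transitivity ((1 - 'X_i) ^+ cap k i * 'X_i ^+ e i : {mpoly int[n]}).
  by rewrite /cap; case: ifP.
rewrite (@onesub_expr_expand _ _ _ _ N); last first.
  have := le_mdeg e i; have := ltn_ord i; rewrite /N /cap; case: ifP => _ /=; lia.
apply: eq_bigr => t _; rewrite -mulr_algl; congr (_ * _).
by rewrite -[RHS]/(in_alg _ _) rmorphM rmorph_sign rmorph_nat.
Qed.

Lemma mcoeff_alt n k (f : {mpoly int[n]}) (m : 'X_{1..n}) :
  (alt k f)@_m =
  \sum_(s : 'S_n | perm_on (init n k) s) (-1) ^+ s * f@_[multinom m (s i) | i < n].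
Proof.
rewrite /alt raddf_sum /=; apply: eq_bigr => s _.
by rewrite mcoeffZ mcoeff_sym.
Qed.

(** The signs of the single factors multiply to one that depends only on total degrees, so it leaves
    the sum over permutations. *)
Lemma mcoeff_alt_rhoX n k (E : nat -> nat) (m : 'X_{1..n}) :
  (alt k (rho n k * 'X_[expo n k E]))@_m =
  (-1) ^+ (mdeg m + mdeg (expo n k E)) *
  \sum_(s : 'S_n | perm_on (init n k) s) (-1) ^+ s *
    \prod_(i < n) (shift_bin (cap k i) (expo n k E i) (m (s i)))%:R.
Proof.
rewrite mcoeff_alt mulr_sumr; apply: eq_bigr => s _.
rewrite mcoeff_rhoX [RHS]mulrCA; congr (_ * _).
rewrite big_split /= prodrXr; congr (_ ^+ _ * _).
  rewrite big_split /= !mdegE; congr (_ + _)%N.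
  by rewrite [RHS](reindex_inj (@perm_inj _ s)); apply: eq_bigr => i _; rewrite mnmE.
by apply: eq_bigr => i _; rewrite mnmE.
Qed.

Lemma msym_alt n k (a b : 'I_n) (f : {mpoly int[n]}) :
  a != b -> (a < k)%N -> (b < k)%N -> msym (tperm a b) (alt k f) = - alt k f.
Proof.
move=> ab ak bk; rewrite /alt raddf_sum -sumrN [RHS](reindex_inj (mulIg (tperm a b))) /=.
have Kt := perm_on_tperm ak bk.
apply: eq_big => [s|s _].
  apply/idP/idP => Ks; first exact: perm_onM.
  by rewrite -[s](mulgK (tperm a b)) tpermV perm_onM.
by rewrite msymZ msymMm odd_permM odd_tperm ab addbT signrN scaleNr opprK.
Qed.

(** By antisymmetry, a coefficient with equal exponents at two of the first k variables is its own
    negative. *)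
Lemma mcoeff_alt_inj n k (f : {mpoly int[n]}) (m : 'X_{1..n}) (a b : 'I_n) :
  (alt k f)@_m != 0 -> (a < k)%N -> (b < k)%N -> m a = m b -> a = b.
Proof.
move=> nz ak bk mab; apply/eqP; apply: contraNT nz => ab; apply/eqP.
have := congr1 (mcoeff m) (msym_alt f ab ak bk); rewrite mcoeffN mcoeff_sym.
have -> : [multinom m (tperm a b i) | i < n] = m; last by lia.
by apply/mnmP => i; rewrite mnmE; case: tpermP => [->|->|].
Qed.

Lemma mdeg_expo n k E : (k <= n)%N -> mdeg (expo n k E) = (\sum_(j < k) E j)%N.
Proof.
move=> kn; rewrite mdegE (big_ord_widen _ _ kn) [RHS]big_mkcond.
by apply: eq_bigr => i _; rewrite mnmE.
Qed.

Definition decreasing_upto (k : nat) (E : nat -> nat) : Prop :=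
  forall i j, (i < j < k)%N -> (E j < E i)%N.

Lemma decreasing_upto_gap k E i j :
  decreasing_upto k E -> (i <= j < k)%N -> (E j + j <= E i + i)%N.
Proof.
move=> Edec; elim: j => [|j IH]; first by rewrite leqn0 => /andP[/eqP ->].
rewrite leq_eqVlt => /andP[/orP[/eqP -> //|ij] jk].
have jjk : (j < j.+1 < k)%N by rewrite ltnSn.
have := Edec _ _ jjk; have := IH; rewrite -ltnS ij (ltnW jk) => /(_ isT); lia.
Qed.

(** A nonzero coefficient has a nonzero term s, which gives e_i <= m(s i) <= e_i + i; antisymmetry
    makes these exponents distinct, and the extremal bound applies. *)
Lemma mdeg_alt_rhoX_le n k (E : nat -> nat) (m : 'X_{1..n}) :
  (k <= n)%N -> decreasing_upto k E ->
  (alt k (rho n k * 'X_[expo n k E]))@_m != 0 ->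
  (mdeg m <= \sum_(j < k) (runmin (fun l => E l + l + l) j - j))%N.
Proof.
move=> kn Edec nz; have inj_m := mcoeff_alt_inj nz; move: nz.
rewrite mcoeff_alt_rhoX => nz.
have /existsP[s /andP[Ks /forallP ms]] : [exists s : 'S_n,
    perm_on (init n k) s &&
    [forall i, expo n k E i <= m (s i) <= expo n k E i + cap k i]%N].
  apply: contraNT nz; rewrite negb_exists => /forallP noms.
  rewrite big1 ?mulr0 // => s Ks; have := noms s; rewrite Ks negb_forall => /existsP[i ni].
  rewrite (bigD1 i) //= [shift_bin _ _ _](_ : _ = 0%N) ?mul0r ?mulr0 //.
  by apply: contraNeq ni => /shift_bin_neq0.
have sk (i : 'I_n) : (i < k)%N -> (s i < k)%N.
  by have := perm_closed i Ks; rewrite !inE => ->.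
(* The exponents as a function on [nat]. Positions from k on contribute 0, since both [cap] and
   [expo] vanish there. *)
pose b j := if insub j is Some i then m (s i) else 0%N.
have bE (i : 'I_n) : b i = m (s i) by rewrite /b valK.
have -> : mdeg m = (\sum_(j < k) b j)%N.
  rewrite mdegE (reindex_inj (@perm_inj _ s)) (big_ord_widen _ _ kn) [RHS]big_mkcond.
  apply: eq_bigr => i _; rewrite bE; case: ifP => // ik.
  by have := ms i; rewrite mnmE /cap ik; lia.
apply: (sum_injective_le_runmin (D := fun l => E l + l)%N) => [i j ijk|i j ik jk|i ik].
- exact: decreasing_upto_gap Edec ijk.
- have [ltin ltjn] := (leq_trans ik kn, leq_trans jk kn).
  rewrite (bE (Ordinal ltin)) (bE (Ordinal ltjn)) => /inj_m.
  by move/(_ (sk (Ordinal ltin) ik) (sk (Ordinal ltjn) jk))/perm_inj/(congr1 val).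
- have ltin := leq_trans ik kn; have := ms (Ordinal ltin).
  by rewrite -bE mnmE /cap /= ik => /andP[].
Qed.

(** The matrix is block lower triangular with an identity block in the lower right corner. *)
Lemma det_identity_columns (R : comPzRingType) n k (kn : (k <= n)%N) (A : 'M[R]_n) :
  (forall i j : 'I_n, (k <= j)%N -> A i j = (i == j)%:R) ->
  \det A = \det (\matrix_(i < k, j < k) A (widen_ord kn i) (widen_ord kn j)).
Proof.
move: (kn) A; rewrite -(subnKC kn); move: (n - k)%N => l {kn}kn A idA.
rewrite -[in LHS](submxK A).
have -> : ursubmx A = 0.
  apply/matrixP => i j; rewrite !mxE idA ?leq_addr // -val_eqE /=.
  by have := ltn_ord i; case: eqP => //; lia.
have -> : drsubmx A = 1%:M.
  by apply/matrixP => i j; rewrite !mxE idA ?leq_addr // (inj_eq (@rshift_inj _ _)).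
rewrite det_lblock det1 mulr1; congr (\det _); apply/matrixP => i j; rewrite !mxE.
by congr (A _ _); apply: val_inj.
Qed.

Lemma mcoeff_alt_rhoX_neq0 n k (E d : nat -> nat) :
  (k <= n)%N -> decreasing_upto k E -> decreasing_upto k d ->
  (forall j, j < k -> E j <= d j <= E j + j)%N ->
  (alt k (rho n k * 'X_[expo n k E]))@_(expo n k d) != 0.
Proof.
move=> kn Edec ddec Ed; rewrite mcoeff_alt_rhoX mulf_neq0 ?signr_eq0 //.
(* The unit columns from k on kill every permutation that moves a position outside the first k. *)
pose A : 'M[int]_n := \matrix_(i, j) (if (j < k)%N then
  (shift_bin j (E j) (expo n k d i))%:R else (i == j)%:R).
have -> : \sum_(s : 'S_n | perm_on (init n k) s) (-1) ^+ s *
    \prod_(i < n) (shift_bin (cap k i) (expo n k E i) (expo n k d (s i)))%:R = \det A.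
  rewrite -det_tr /determinant big_mkcond; apply: eq_bigr => s _.
  case: ifPn => [Ks|nKs].
    congr (_ * _); apply: eq_bigr => i _; rewrite !mxE /cap; case: ifP => ik.
      by rewrite mnmE ik.
    have si : s i = i by apply: (out_perm Ks); rewrite inE ik.
    by rewrite si eqxx !mnmE ik.
  have /subsetPn[i nsi] := nKs; rewrite inE => nik.
  by rewrite (bigD1 i) //= !mxE (negPf nik) (negPf nsi) mul0r mulr0.
rewrite (det_identity_columns kn) => [|i j]; last by rewrite mxE leqNgt => /negPf ->.
apply: lt0r_neq0; rewrite (_ : \matrix_(i, j) _ = bin_mx (fun i : 'I_k => d i) (fun i : 'I_k => E i)).
  apply: bin_mx_det_gt0 => [i j ij|i j ij|j]; last exact: Ed.
  - by apply: ddec; rewrite ij ltn_ord.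
  - by apply: Edec; rewrite ij ltn_ord.
by apply/matrixP => i j; rewrite !mxE mnmE /= !ltn_ord.
Qed.

(** The upper bound is attained at d_j = [runmin F j] - j: this is strictly decreasing and satisfies
    e_j <= d_j <= e_j + j. Note that [msize] is the degree plus one. *)
Lemma msize_alt_rhoX n k (E : nat -> nat) :
  (k <= n)%N -> decreasing_upto k E ->
  msize (alt k (rho n k * 'X_[expo n k E])) =
  (\sum_(j < k) (runmin (fun l => E l + l + l) j - j)).+1%N.
Proof.
move=> kn Edec; pose F l := (E l + l + l)%N; pose d j := (runmin F j - j)%N.
have geF j : (j < k -> E j + j <= runmin F j)%N.
  move=> jk; apply: runmin_ge => l lj.
  have := @decreasing_upto_gap k E l j Edec; rewrite lj jk /F => /(_ isT); lia.
have leF i j : (i <= j -> runmin F j <= runmin F i)%N.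
  by move=> ij; apply: runmin_ge => l li; apply: runmin_le; exact: leq_trans ij.
apply/eqP; rewrite eqn_leq; apply/andP; split.
  rewrite msizeE; apply/bigmax_leqP_seq => m; rewrite mcoeff_msupp => nz _.
  exact: mdeg_alt_rhoX_le.
rewrite -(mdeg_expo d kn); apply: msize_mdeg_lt; rewrite mcoeff_msupp.
apply: mcoeff_alt_rhoX_neq0 => // [i j /andP[ij jk]|j jk].
  by have := geF j jk; have := leF i j (ltnW ij); rewrite /d; lia.
by have := geF j jk; have := @runmin_le F j j (leqnn j); rewrite /d /F; lia.
Qed.

(** * From Grassmannian to dominant permutations, and the degree of G_w *)

(** Agreeing from k on, u and w have the same values on the first k positions, in decreasing and
    increasing order. A mismatch at i would repeat a value already matched at a smaller index. *)
Lemma reversed_on_init n k (u w : 'S_n) : (k <= n)%N ->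
  (forall i j : 'I_n, (i < j)%N -> (j < k)%N -> (u j < u i)%N) ->
  (forall i j : 'I_n, (i < j)%N -> (j < k)%N -> (w i < w j)%N) ->
  (forall i : 'I_n, (k <= i)%N -> u i = w i) ->
  forall i j : 'I_n, (i + j).+1 = k -> u i = w j.
Proof.
move=> kn udec winc uw i; have [m] := ubnP i; elim: m i => // m IH i lem j ijk.
have [ik jk] : (i < k)%N /\ (j < k)%N by lia.
apply: val_inj; apply/eqP; rewrite eqn_leq; apply/andP; split.
- pose a := (w^-1 (u i))%g; have wa : w a = u i by rewrite permKV.
  have ak : (a < k)%N.
    by rewrite ltnNge; apply/negP => ka; move: (uw a ka); rewrite wa => /perm_inj/(congr1 val) /=; lia.
  rewrite -wa; case: (ltngtP a j) => [aj|ja|/val_inj ->] //.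
    exact/ltnW/winc.
  have lti' : (k - a.+1 < n)%N by have := ltn_ord i; lia.
  have := IH (Ordinal lti') _ a; rewrite wa => E.
  have /perm_inj/(congr1 val) /= : u (Ordinal lti') = u i by apply: E => /=; lia.
  lia.
- pose b := (u^-1 (w j))%g; have ub : u b = w j by rewrite permKV.
  have bk : (b < k)%N.
    by rewrite ltnNge; apply/negP => kb; move: (uw b kb); rewrite ub => /perm_inj/(congr1 val) /=; lia.
  rewrite -ub; case: (ltngtP b i) => [bi|ib|/val_inj ->] //; last exact/ltnW/udec.
  have ltj' : (k - b.+1 < n)%N by have := ltn_ord j; lia.
  have := IH b _ (Ordinal ltj'); rewrite ub => E.
  have /perm_inj/(congr1 val) /= : w j = w (Ordinal ltj') by apply: E => /=; lia.
  lia.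
Qed.

Lemma card_perm_lt n (u : 'S_n) m : (m <= n)%N -> #|[set j : 'I_n | (u j < m)%N]| = m.
Proof.
move=> mn; rewrite -sum1dep_card.
rewrite (reindex_inj (@perm_inj _ (u^-1)%g)) /=.
under eq_bigl do rewrite permKV.
by rewrite -(big_ord_widen _ (fun _ => 1%N) mn) sum1_card card_ord.
Qed.

Definition perm_at n (w : 'S_n) (i : nat) : nat := oapp (fun j : 'I_n => val (w j)) 0%N (insub i).

Lemma perm_atE n (w : 'S_n) (i : 'I_n) : perm_at w i = w i.
Proof. by rewrite /perm_at valK. Qed.

(** G_w is symmetric in the first k variables, so it can be moved inside A and replaced by the
    monomial of u. The code of u is u_i for i < k, all smaller values coming later, and 0 from k
    on. *)
Lemma alt_rho_groth n k (w : 'S_n) : (k <= n)%N ->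
  (forall i j : 'I_n, (i < j)%N -> (j < k)%N -> (w i < w j)%N) ->
  (forall i j : 'I_n, (i < j)%N -> (k <= i)%N -> (w i < w j)%N) ->
  alt k (rho n k) * groth w =
  alt k (rho n k * 'X_[expo n k (fun j => perm_at w (k - j.+1))]).
Proof.
move=> kn winc winc'.
rewrite -altM; last first.
  apply: msym_adjacent_fixed => a b ba bk; rewrite (@groth_ascent _ _ a b).
    by rewrite pidiff_sym // -val_eqE ba neq_ltn ltnSn.
  by rewrite /ascent ba eqxx winc // ba.
have [u [udec uw ->]] := alt_rho_groth_reverse k w; congr (alt k (_ * _)).
have uE := reversed_on_init kn udec winc uw.
rewrite groth_dominant => [|i j l ij jl]; last first.
  have [jk|kj] := ltnP j k; first by have := udec i j ij jk; lia.
  have := winc' j l jl kj; rewrite -!uw //; [lia | lia].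
congr 'X_[_]; apply/mnmP => i; rewrite !mnmE; case: ltnP => [ik|ki]; last first.
  apply: eq_card0 => j; rewrite !inE; apply/negP => /andP[ij].
  have := winc' i j ij ki; rewrite !uw //; [lia | lia].
have lti' : (k - i.+1 < n)%N by lia.
rewrite (perm_atE w (Ordinal lti')) -(uE i) /=; last lia.
rewrite -[RHS](card_perm_lt u (ltnW (ltn_ord (u i)))).
apply: eq_card => j; rewrite !inE; apply: andb_idl => uji.
rewrite ltnNge leq_eqVlt; apply/negP => /orP[/eqP/val_inj ji|ji].
  by rewrite ji ltnn in uji.
by have := udec j i ji ik; lia.
Qed.

Lemma groth1 n : groth (1%g : 'S_n) = 1.
Proof.
rewrite groth_dominant => [|i j l ij jl]; last by rewrite !perm1; lia.
rewrite [[multinom _ | _ < _]](_ : _ = 0%MM) ?mpolyX0 //.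
apply/mnmP => i; rewrite !mnmE; apply: eq_card0 => j; rewrite !inE !perm1; lia.
Qed.

Lemma mpoly_degE n (p : {mpoly int[n]}) : p != 0 -> mpoly_deg p = (msize p).-1.
Proof.
move=> nz; rewrite -(mlead_deg nz) /=; apply/eqP; rewrite eqn_leq; apply/andP; split.
  by apply/bigmax_leqP_seq => m mp _; rewrite -ltnS (mlead_deg nz) msize_mdeg_lt.
by apply: leq_bigmax_seq => //; exact: mlead_supp.
Qed.

(** Degrees add in a domain, so deg G_w = deg A(rho * x^e) - deg A(rho), and the case w = 1 provides
    the second degree. *)
Lemma mpoly_deg_groth n k (w : 'S_n) (lam : nat -> nat) : (k <= n)%N ->
  (forall i j : 'I_n, (i < j)%N -> (j < k)%N -> (w i < w j)%N) ->
  (forall i j : 'I_n, (i < j)%N -> (k <= i)%N -> (w i < w j)%N) ->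
  (forall j, j < k -> perm_at w (k - j.+1) = lam j + (k - j.+1))%N ->
  mpoly_deg (groth w) = (\sum_(j < k) runmin (fun l => lam l + l) j)%N.
Proof.
move=> kn winc winc' lamE.
have dec (v : 'S_n) : (forall i j : 'I_n, (i < j)%N -> (j < k)%N -> (v i < v j)%N) ->
    decreasing_upto k (fun j => perm_at v (k - j.+1)).
  move=> vinc i j /andP[ij jk].
  have [lti ltj] : (k - i.+1 < n)%N /\ (k - j.+1 < n)%N by lia.
  rewrite (perm_atE v (Ordinal lti)) (perm_atE v (Ordinal ltj)).
  by apply: vinc => /=; lia.
have runminD F c j : runmin (fun l => F l + c)%N j = (runmin F j + c)%N.
  by elim: j => //= j ->; rewrite addn_minl.
have eq_runmin F G j : (forall l, l <= j -> F l = G l)%N -> runmin F j = runmin G j.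
  elim: j => [|j IH] FG /=; first exact: FG.
  by rewrite FG // IH // => l lj; apply/FG/leqW.
have size_w := msize_alt_rhoX kn (dec w winc).
have inc1 (i j : 'I_n) : (i < j)%N -> ((1%g : 'S_n) i < (1%g : 'S_n) j)%N by rewrite !perm1.
have size_1 := msize_alt_rhoX kn (dec _ (fun i j ij _ => inc1 i j ij)).
rewrite -alt_rho_groth // in size_w.
rewrite -alt_rho_groth ?groth1 ?mulr1 // in size_1; try by move=> *; exact: inc1.
have nz : alt k (rho n k) * groth w != 0 by rewrite -msize_poly_eq0 size_w.
have := nz; rewrite mulf_eq0 negb_or => /andP[nz1 nzw].
(* With e_l = mu_l + k-1-l one has e_l + 2l = mu_l + l + (k-1); the constant leaves the minimum and
   yields the sum of k-1-j, which cancels against the case w = 1. *)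
have sumE (v : 'S_n) (mu : nat -> nat) :
    (forall j, j < k -> perm_at v (k - j.+1) = mu j + (k - j.+1))%N ->
    (\sum_(j < k) (runmin (fun l => perm_at v (k - l.+1) + l + l) j - j) =
     \sum_(j < k) runmin (fun l => mu l + l) j + \sum_(j < k) (k - j.+1))%N.
  move=> vE; rewrite -big_split /=; apply: eq_bigr => j _.
  rewrite (eq_runmin _ (fun l => mu l + l + k.-1)%N) => [|l lj]; last first.
    by rewrite vE; have := ltn_ord j; lia.
  by rewrite runminD; have := ltn_ord j; lia.
have sum0 : (\sum_(j < k) runmin (fun l => 0 + l) j = 0)%N.
  by apply: big1 => j _; apply/eqP; rewrite -leqn0; exact: (@runmin_le (fun l => 0 + l)%N j 0).
have := size_w; rewrite msizeM // size_1 (sumE w lam lamE) (sumE 1%g (fun=> 0%N)) => [|j jk].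
  rewrite sum0 mpoly_degE //; have := msize_poly_eq0 (groth w); rewrite (negPf nzw).
  move: (mmeasure _ _) (\sum_(j < k) (k - j.+1))%N (\sum_(j < k) runmin _ j)%N.
  by case=> [|s] B S //=; lia.
have lt : (k - j.+1 < n)%N by lia.
by rewrite (perm_atE _ (Ordinal lt)) perm1.
Qed.

(** * Running minima of a partition in terms of [sylv] and blocks *)

Lemma staircase_subP m nu :
  reflect (forall l, l < m -> m <= nth 0 nu l + l)%N (staircase_sub m nu).
Proof.
apply: (iffP allP) => [H l lm|H j].
  by have := H l.+1; rewrite mem_iota /= => /(_ ltac:(lia)); lia.
by rewrite mem_iota => /andP[j1 jm]; have := H j.-1; rewrite prednK //; lia.
Qed.

Lemma sylv_le_size nu : (sylv nu <= size nu)%N.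
Proof. by apply/bigmax_leqP => i _; rewrite -ltnS. Qed.

Lemma staircase_sylv nu : staircase_sub (sylv nu) nu.
Proof.
rewrite /sylv; elim/big_ind: _ => // x y Px Py.
by rewrite /maxn; case: ifP.
Qed.

Lemma sylv_ge nu m : (m <= size nu)%N -> staircase_sub m nu -> (m <= sylv nu)%N.
Proof.
by rewrite -ltnS => lt st; apply: (@leq_bigmax_cond _ _ (fun i : 'I_(size nu).+1 => val i) (Ordinal lt)).
Qed.

(** Let r be the minimum and i0 the start of the block of j. Then r <= v + i0, and r <= lam_l + l
    says that the staircase of size r - v fits. Conversely, lam_l + l >= v + [sylv] follows from the
    staircase for l < [sylv], and from lam_l >= v otherwise. *)
Lemma runmin_sylv (lam : seq nat) j : sorted geq lam -> (j < size lam)%N ->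
  let v := nth 0%N lam j in
  runmin (fun l => nth 0 lam l + l)%N j =
  (v + sylv [seq x - v | x <- take (index v lam) lam])%N.
Proof.
move=> slam jlt v; set i0 := index v lam; set nu := map _ _; set r := runmin _ _.
have vlam : v \in lam by exact: mem_nth.
have mono l l' : (l <= l' -> l' < size lam -> nth 0 lam l' <= nth 0 lam l)%N.
  move=> ll' lt'; apply: (sorted_leq_nth (leT := geq)) => //.
  - by move=> a b c /= h1 h2; exact: leq_trans h2 h1.
  - by move=> a; exact: leqnn.
  - by rewrite inE; exact: leq_ltn_trans ll' lt'.
have i0j : (i0 <= j)%N by rewrite leqNgt; apply/negP => /(before_find 0%N) /=; rewrite eqxx.
have i0lt : (i0 < size lam)%N by rewrite index_mem.
have size_nu : size nu = i0 by rewrite size_map size_takel // ltnW.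
have nuE l : (l < i0)%N -> nth 0%N nu l = (nth 0 lam l - v)%N.
  by move=> li; rewrite (nth_map 0%N) ?nth_take // size_takel // ltnW.
have vi0 : nth 0%N lam i0 = v by exact: nth_index.
apply/eqP; rewrite eqn_leq; apply/andP; split.
  suff : (r - v <= sylv nu)%N by lia.
  have r_le l : (l <= j -> r <= nth 0 lam l + l)%N by move=> lj; exact: runmin_le.
  have ri0 : (r - v <= i0)%N by have := r_le _ i0j; lia.
  apply: sylv_ge; first by rewrite size_nu.
  apply/staircase_subP => l lt; rewrite nuE; last lia.
  by have := r_le l; lia.
have sz := sylv_le_size nu; rewrite size_nu in sz.
apply: runmin_ge => l lj.
have := mono l j lj jlt; rewrite -/v => vl.
case: (ltnP l (sylv nu)) => [lm|]; last by lia.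
have := staircase_subP _ _ (staircase_sylv nu) l lm; rewrite nuE; lia.
Qed.

Lemma map_nth_pred_iota (s : seq nat) m : (m <= size s)%N ->
  [seq nth 0%N s i.-1 | i <- iota 1 m] = take m s.
Proof.
move=> ms; apply: (@eq_from_nth _ 0%N) => [|i].
  by rewrite size_map size_iota size_takel.
rewrite size_map size_iota => im.
by rewrite (nth_map 0%N) ?size_iota // nth_iota // nth_take.
Qed.

Lemma size_Pblock lam h : size (Pblock lam h.+1) = count_mem (nth 0%N (undup lam) h) lam.
Proof.
rewrite /Pblock size_filter /=; move: (nth _ _ h) => v.
by rewrite -[X in _ = count_mem v X]take_size -map_nth_pred_iota // count_map.
Qed.

Lemma head_Pblock lam h : (h < nblocks lam)%N ->
  head 0%N (Pblock lam h.+1) = (index (nth 0%N (undup lam) h) lam).+1.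
Proof.
move=> hlt; set v := nth _ _ _.
have vlam : v \in lam by rewrite -mem_undup mem_nth.
have head_filter (p : pred nat) s : head 0%N (filter p s) = nth 0%N s (find p s).
  by elim: s => //= a s IH; case: (p a).
rewrite /Pblock head_filter -/v.
have -> : find (fun i => nth 0%N lam i.-1 == v) (iota 1 (size lam)) = index v lam.
  by rewrite /index -[X in _ = find _ X]take_size -map_nth_pred_iota // find_map.
by rewrite nth_iota ?add1n // index_mem.
Qed.

Lemma lam_hE lam h : (h < nblocks lam)%N -> let v := nth 0%N (undup lam) h in
  lam_h lam h = [seq (x - v)%N | x <- take (index v lam) lam].
Proof.
move=> hlt v; have vlam : v \in lam by rewrite -mem_undup mem_nth.
rewrite /lam_h head_Pblock //= -/v nth_index //.
by rewrite -(map_nth_pred_iota (s := lam)) ?index_size // -map_comp.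
Qed.

(** Sortedness matters because [undup] keeps last occurrences. *)
Lemma head_undup_sorted (s : seq nat) x : sorted geq (x :: s) -> nth 0%N (undup (x :: s)) 0 = x.
Proof.
elim: s x => [|y s IH] x; first by [].
move=> /= /andP[yx pys]; case: ifP => // xs.
have := IH y pys; rewrite /= => ->; apply/eqP; rewrite eqn_leq yx /=.
move: xs; rewrite inE => /orP[/eqP -> //|xs].
by have /allP/(_ _ xs) := order_path_min (fun b a c (h1 : geq a b) (h2 : geq b c) => leq_trans h2 h1) pys.
Qed.

(** Grouping the entries by value: an entry x lies in the block numbered by its index in
    [undup lam], counted from 0. *)
Lemma sum_index_undup (lam : seq nat) (g : nat -> nat) :
  (\sum_(x <- lam) g (index x (undup lam)) =
   \sum_(0 <= h < nblocks lam) size (Pblock lam h.+1) * g h)%N.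
Proof.
transitivity (\sum_(x <- lam) \sum_(0 <= h < nblocks lam)
    (x == nth 0%N (undup lam) h) * g h)%N.
  apply: eq_big_seq => x xlam.
  have xlt : (index x (undup lam) < nblocks lam)%N by rewrite index_mem mem_undup.
  rewrite big_mkord (bigD1 (Ordinal xlt)) //= nth_index ?mem_undup // eqxx mul1n.
  rewrite big1 ?addn0 // => h; rewrite -val_eqE /= => nh.
  by case: eqP => // xh; case/eqP: nh; rewrite xh index_uniq ?undup_uniq.
rewrite exchange_big /=; apply: eq_bigr => h _; rewrite -big_distrl size_Pblock /=.
by congr (_ * _)%N; rewrite -sum1_count [RHS]big_mkcond.
Qed.

Lemma sum_runmin_partition (lam : seq nat) : sorted geq lam ->
  (\sum_(j < size lam) runmin (fun l => nth 0 lam l + l) j =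
   psize lam +
   \sum_(1 <= h < nblocks lam) size (Pblock lam h.+1) * sylv (lam_h lam h))%N.
Proof.
move=> slam; pose g h := sylv (lam_h lam h).
transitivity (\sum_(x <- lam) (x + g (index x (undup lam))))%N.
  rewrite (big_nth 0%N) big_mkord; apply: eq_bigr => j _.
  have jl : nth 0%N lam j \in lam by exact: mem_nth.
  rewrite runmin_sylv // /g lam_hE ?nth_index ?mem_undup //.
  by rewrite /nblocks index_mem mem_undup.
rewrite big_split /= /psize sumnE sum_index_undup; congr (_ + _)%N.
case: (posnP (nblocks lam)) => [->|pos]; first by rewrite !big_geq.
(* The first block drops out: nothing precedes it, so its [lam_h] is empty with [sylv] 0. *)
rewrite big_ltn // [g 0%N](_ : _ = 0%N) ?muln0 //.
apply/eqP; rewrite -leqn0; apply: leq_trans (sylv_le_size _) _.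
rewrite lam_hE // size_map; case: lam slam pos {g} => // x s slam _.
by rewrite head_undup_sorted //= eqxx.
Qed.

(** * One-line notation, the unique descent and the degree formula *)

Lemma wvalE n (w : 'S_n) i : (i < n)%N -> wval w i.+1 = (perm_at w i).+1.
Proof.
move=> lt; rewrite /wval /oneline /= (nth_map (Ordinal lt)) ?size_enum_ord //.
by rewrite (perm_atE w (Ordinal lt)) (nth_ord_enum (Ordinal lt) (Ordinal lt)).
Qed.

Lemma single_descent n (w : 'S_n) k : descents w = [:: k] ->
  [/\ (0 < k < n)%N,
      forall i j : 'I_n, (i < j)%N -> (j < k)%N -> (w i < w j)%N &
      forall i j : 'I_n, (i < j)%N -> (k <= i)%N -> (w i < w j)%N].
Proof.
move=> dw.
have memd i : (i \in descents w) = (i == k) by rewrite dw inE.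
have kn : (0 < k < n)%N.
  by have := memd k; rewrite eqxx mem_filter mem_iota => /andP[_]; lia.
have adj (a b : 'I_n) : val b = (val a).+1 -> val b != k -> (w a < w b)%N.
  (* Descents are numbered from 1, so the number [val b] concerns the 0-based positions a and b. *)
  move=> ba bk; have := memd b; rewrite (negPf bk) mem_filter mem_iota.
  have := ltn_ord b; rewrite ba => ltb.
  rewrite !wvalE //; last exact: ltnW.
  rewrite -[(val a).+1]ba !perm_atE.
  have : w a != w b :> nat by apply: contra_eqN ba => /eqP/val_inj/perm_inj ->; lia.
  lia.
split=> // i j ij.
  apply: (@adjacent_trans n (fun x => (x < k)%N) (fun x y => (w x < w y)%N)) => //.
  - by move=> y x z; exact: ltn_trans.
  - by move=> x y; exact: leq_ltn_trans.
  - by move=> a b ba bk; apply: adj => //; rewrite neq_ltn bk.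
move=> ki.
(* Including x < y in the relation makes the guarded comparison transitive: k <= x then passes to
   y. *)
have /andP[_ /implyP -> //] : (i < j)%N && ((k <= i)%N ==> (w i < w j)%N).
apply: (@adjacent_trans n xpredT (fun x y => (x < y)%N && ((k <= x)%N ==> (w x < w y)%N))) => //.
- move=> y x z /andP[xy /implyP wxy] /andP[yz /implyP wyz]; rewrite (ltn_trans xy yz) /=.
  by apply/implyP => kx; apply: ltn_trans (wxy kx) (wyz (leq_trans kx (ltnW xy))).
- move=> a b ba _; rewrite {1}ba ltnSn; apply/implyP => ka; apply: adj => //.
  by rewrite ba neq_ltn ltnS ka orbT.
Qed.

Theorem theorem3p11 (n : nat) (w : 'S_n) (k : nat) :
  descents w = [:: k] ->
  let lam := grass_partition w k in
  mpoly_deg (groth w) =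
    (psize lam +
     \sum_(1 <= h < nblocks lam) size (Pblock lam h.+1) * sylv (lam_h lam h))%N.
Proof.
move=> /single_descent[/andP[k0 kn] winc winc'] lam.
have inc i j : (i < j < k)%N -> (perm_at w i < perm_at w j)%N.
  move=> /andP[ij jk]; have ltj := ltn_trans jk kn.
  rewrite (perm_atE w (Ordinal ltj)) (perm_atE w (Ordinal (ltn_trans ij ltj))).
  exact: winc.
(* Increasing values satisfy w_i >= i, so the truncated subtraction in [grass_partition] is
   exact. *)
have ge_id i : (i < k)%N -> (i <= perm_at w i)%N.
  elim: i => // i IH ik; have := inc i i.+1; rewrite ltnSn ik => /(_ isT).
  by have := IH (ltnW ik); lia.
have size_lam : size lam = k by rewrite size_map size_iota.
have nth_lam j : (j < k)%N -> nth 0%N lam j = (perm_at w (k - j.+1) - (k - j.+1))%N.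
  move=> jk; rewrite (nth_map 0%N) ?size_iota // nth_iota // add1n subSS.
  have -> : (k - j = (k - j.+1).+1)%N by lia.
  by rewrite wvalE; lia.
rewrite -sum_runmin_partition ?size_lam.
  apply: (mpoly_deg_groth (lam := fun l => nth 0%N lam l)) => // [|j jk]; first exact: ltnW.
  by rewrite nth_lam // subnK // ge_id //; lia.
apply/(sortedP 0%N) => i; rewrite size_lam => ik; rewrite /geq /= !nth_lam //; last exact: ltnW.
have := inc (k - i.+2)%N (k - i.+1)%N; lia.
Qed.
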